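(* Let $\{1,\varphi_k:k\ge1\}$ be an orthonormal system (basis) in $L^2(0,1)$ and $(\lambda_k)_{k\ge1}$ real numbers with $\sum_k\lambda_k^2<\infty$ and $$1+\sum_{k=1}^\infty\lambda_k\varphi_k(x)\varphi_k(y)\ge0\quad\text{for all }(x,y)\in[0,1]^2.$$ Consider the stationary Markov chain generated, with an absolutely continuous marginal distribution, by the copula $$C(u,v)=uv+\sum_{k=1}^\infty\lambda_k\int_0^u\varphi_k(x)\,dx\int_0^v\varphi_k(y)\,dy.$$ (1) If the sequence $(\varphi_k)$ is uniformly bounded and $\sup_k|\lambda_k|<1$, then the Markov chain is $\psi$-mixing. (2) If $\sup_k|\lambda_k|<1$, then the Markov chain is $\rho$-mixing. (3) If $$1+\sum_{k=1}^\infty\lambda_k\alpha_k>0,\qquad \alpha_k=\begin{cases}\max\varphi_k^2&\text{if }\lambda_k<0,\\ \min\varphi_k\max\varphi_k&\text{if }\lambda_k>0,\end{cases}$$ then the Markov chain is $\psi'$-mixing.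
   Context: A (bivariate) copula is the restriction to $[0,1]^2$ of a bivariate cumulative distribution function with uniform marginals. The stationary Markov chain $(X_n)_{n\ge0}$ generated by $C$ and a marginal distribution function $F$ has $X_n\sim F$ and $(F(X_n),F(X_{n+1}))$ with joint distribution function $C$. With $P(A)=P(X_0\in A)$ and $P^n(A\cap B)=P(X_0\in A,X_n\in B)$ for Borel sets $A,B$: $$\rho_n=\sup_f\{|\mathbb{E}(f(X_0)f(X_n))|:\mathbb{E}f(X_0)=0,\ \mathbb{E}f^2(X_0)=1\},$$ $$\psi_n=\sup_{P(A)P(B)>0}\frac{|P^n(A\cap B)-P(A)P(B)|}{P(A)P(B)},\qquad \psi'_n=\inf_{P(A)P(B)>0}\frac{P^n(A\cap B)}{P(A)P(B)}.$$ The chain is $\rho$-mixing if $\rho_n\to0$, $\psi$-mixing if $\psi_n\to0$, and $\psi'$-mixing if $\psi'_n\to1$. Maxima and minima of $\varphi_k$ are over $[0,1]$ (assumed to exist in item (3) whenever $\lambda_k\ne0$); terms with $\lambda_k=0$ contribute $0$. *)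

(* Defs.v *)
From HB Require Import structures.
From mathcomp Require Import all_boot all_order all_algebra.
From mathcomp Require Import all_classical all_reals all_analysis.

Set Implicit Arguments.
Unset Strict Implicit.
Unset Printing Implicit Defensive.

Import Order.TTheory GRing.Theory Num.Theory.
Import numFieldNormedType.Exports.

Local Open Scope classical_set_scope.
Local Open Scope ring_scope.

(* Families indexed by k >= 1 in the mathematical text are sequences indexed by
   nat here: [phi k] and [lam k] stand for phi_{k+1} and lambda_{k+1}. *)

Section L2.
Context {R : realType}.
Implicit Types (f g : R -> R) (e phi : nat -> R -> R).

Local Notation mu := (@lebesgue_measure R).
Local Notation unit_itv := [set` `[(0 : R), 1]].

(* Functions are considered on [0, 1]; their values outside are irrelevant.
   L^2(0, 1) and L^2([0, 1]) coincide, but the pointwise conditions below also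
   involve the end points. *)
Definition square_integrable01 f : Prop :=
  measurable_fun unit_itv f /\
  mu.-integrable unit_itv (fun x => (f x ^+ 2)%:E).

Definition inner01 f g : R := \int[mu]_(x in unit_itv) (f x * g x).

Definition orthonormal01 e : Prop :=
  (forall k, square_integrable01 (e k)) /\
  (forall j k, inner01 (e j) (e k) = (j == k)%:R).

Definition orthonormal_basis01 e : Prop :=
  orthonormal01 e /\
  forall f, square_integrable01 f ->
    (fun n => \int[mu]_(x in unit_itv)
       (f x - \sum_(k < n) inner01 f (e k) * e k x) ^+ 2) @ \oo --> (0 : R).

Definition with_one phi : nat -> R -> R :=
  fun k => if k is j.+1 then phi j else cst 1.

End L2.

Section copula.
Context {R : realType}.
Implicit Types (lam alpha : nat -> R) (phi : nat -> R -> R).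

Local Notation mu := (@lebesgue_measure R).
Local Notation unit_itv := [set` `[(0 : R), 1]].

(* The series is summed in the extended reals, so that the value +oo is allowed
   at some points (e.g. on the diagonal), as for an unbounded density. *)
Definition nonnegative_density lam phi : Prop :=
  forall x y : R, x \in `[0, 1] -> y \in `[0, 1] ->
    let S := fun n => (\sum_(k < n) lam k * phi k x * phi k y)%:E in
    cvgn S /\ (0 <= 1 + limn S)%E.

Definition series_copula lam phi (u v : R) : R :=
  u * v + limn (series (fun k =>
    lam k * (\int[mu]_(x in `[0, u]) phi k x)
          * (\int[mu]_(y in `[0, v]) phi k y))).

Definition is_max (A : set R) (m : R) : Prop := A m /\ ubound A m.

Definition is_min (A : set R) (m : R) : Prop := A m /\ lbound A m.

(* [alpha k] is left free when [lam k = 0]: it only occurs in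
   [lam k * alpha k]. *)
Definition is_alpha lam phi alpha : Prop :=
  forall k,
    (lam k < 0 -> is_max ((fun x => phi k x ^+ 2) @` unit_itv) (alpha k)) /\
    (0 < lam k -> exists m M : R,
        [/\ is_min (phi k @` unit_itv) m, is_max (phi k @` unit_itv) M
          & alpha k = m * M]).

Definition absolutely_continuous_df (F : R -> R) : Prop :=
  exists f : R -> R,
    [/\ measurable_fun setT f, (forall t, 0 <= f t)
      & forall x, (F x)%:E = (\int[mu]_(t in `]-oo, x]) (f t)%:E)%E].

End copula.

Section markov_chain.
Context {d : measure_display} {T : measurableType d} {R : realType}.
Variables (P : probability T R) (X : nat -> {RV P >-> R}).

Definition sigma_of (D : set nat) : set (set T) :=
  <<s \bigcup_(i in D) preimage_set_system setT (X i) measurable >>.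

(* [Y] is a version of the conditional probability P(E | G). *)
Definition cond_prob (G : set (set T)) (E : set T) (Y : T -> R) : Prop :=
  [/\ (forall B : set R, measurable B -> G (Y @^-1` B)),
      P.-integrable setT (EFin \o Y)
    & forall A, G A -> P (A `&` E) = (\int[P]_(w in A) (Y w)%:E)%E].

(* P(X_{n+1} \in B | X_0, ..., X_n) = P(X_{n+1} \in B | X_n) a.s. *)
Definition markov_property : Prop :=
  forall (n : nat) (B : set R), measurable B ->
    exists Y : T -> R,
      cond_prob (sigma_of `I_n.+1) (X n.+1 @^-1` B) Y /\
      cond_prob (sigma_of [set n]) (X n.+1 @^-1` B) Y.

Definition stationary : Prop :=
  forall (h m : nat) (A : nat -> set R), (forall i, measurable (A i)) ->
    P (\bigcap_(i in `I_m) (X (h + i)%N @^-1` A i)) =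
    P (\bigcap_(i in `I_m) (X i @^-1` A i)).

Definition generated_chain (C : R -> R -> R) (F : R -> R) : Prop :=
  [/\ stationary, markov_property,
      (forall n x, cdf (X n) x = (F x)%:E)
    & forall n (u v : R), u \in `[0, 1] -> v \in `[0, 1] ->
        P [set w | F (X n w) <= u /\ F (X n.+1 w) <= v] = (C u v)%:E].

Definition law (A : set R) : R := fine (P (X 0%N @^-1` A)).

Definition joint_law (n : nat) (A B : set R) : R :=
  fine (P (X 0%N @^-1` A `&` X n @^-1` B)).

(* The coefficients are extended reals since, e.g., psi_n can be infinite for
   small n. *)
Definition rho_coef (n : nat) : \bar R :=
  ereal_sup [set (`| 'E_P[fun w => (f (X 0%N w) * f (X n w))%R] |)%E
    | f in [set f : R -> R |
        [/\ measurable_fun setT f,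
            ('E_P[fun w => f (X 0%N w)] = 0)%E
          & ('E_P[fun w => (f (X 0%N w) ^+ 2)%R] = 1)%E]]].

Definition charged : set (set R * set R) :=
  [set AB | [/\ measurable AB.1, measurable AB.2 & 0 < law AB.1 * law AB.2]].

Definition psi_coef (n : nat) : \bar R :=
  ereal_sup [set (`|joint_law n AB.1 AB.2 - law AB.1 * law AB.2| /
                  (law AB.1 * law AB.2))%:E | AB in charged].

Definition psi'_coef (n : nat) : \bar R :=
  ereal_inf [set (joint_law n AB.1 AB.2 /
                  (law AB.1 * law AB.2))%:E | AB in charged].

Definition rho_mixing : Prop := rho_coef @ \oo --> 0%E.

Definition psi_mixing : Prop := psi_coef @ \oo --> 0%E.

Definition psi'_mixing : Prop := psi'_coef @ \oo --> 1%E.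

End markov_chain.

(* Main.v *)
Require Import Defs.
From HB Require Import structures.
From mathcomp Require Import all_boot all_order all_algebra.
From mathcomp Require Import all_classical all_reals all_analysis.
From mathcomp Require Import measurable_realfun ring lra.
Import Order.TTheory GRing.Theory Num.Theory.
Import numFieldNormedType.Exports.
Local Open Scope classical_set_scope.
Local Open Scope ring_scope.
Set Implicit Arguments.
Unset Strict Implicit.
Unset Printing Implicit Defensive.

(* The variables U_n = F(X_n) are uniform on [0, 1] and generate the same
   sigma-algebras as the X_n up to null sets, so the functions e_0 = 1,
   e_{k+1} = phi_{k+1} of U_n form an orthonormal basis of L^2(sigma(X_n)).
   The copula makes conditioning on the past diagonal in this basis:
   E(e_k(U_{n+1}) | X_0, ..., X_n) = l_k e_k(U_n), with l_0 = 1 and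
   l_{k+1} = lambda_{k+1}. Hence
     E(f(U_0) g(U_n)) = sum_k l_k^n <f, e_k> <g, e_k>,
   from which (1) and (2) follow by bounding the coefficients of indicators,
   respectively by Bessel's inequality. For (3), integrating the termwise bound
   lambda_k phi_k(x) phi_k(y) >= lambda_k alpha_k over A x B gives
   P^1(A, B) >= eps P(A) P(B) with eps = 1 + sum_k lambda_k alpha_k > 0, and
   Doeblin's argument turns it into P^n(A, B) >= (1 - (1 - eps)^n) P(A) P(B). *)

(** * Square-integrable random variables *)

(** The copula controls (U_n, U_{n+1}) only on products of half-lines, through a numerical series,
    and diagonality is extracted from it weakly. Since the sum of l_k^2 is finite, the partial sums
    of sum_k l_k E(Z e_k(V)) e_k(W) stay bounded in L^2; for a sequence bounded in L^2, a zero limit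
    against half-line events of W extends to all of L^2(sigma(W)) by a pi-lambda argument, and
    testing against e_k(W) isolates one coefficient. To condition on X_0 and not only on U_n, the
    Markov property replaces the event U_{n+1} <= v by a function y(U_n), whose coefficients come
    from the symmetry of the series in its two arguments. In (1), the sum of |lambda_k| may diverge,
    so two factors lambda_k are kept for summability and the geometric rate starts at n = 2. *)

Section L2.
Context {d : measure_display} {T : measurableType d} {R : realType}.
Variable P : probability T R.
Implicit Types f g h : T -> R.

Definition L2 f : Prop :=
  measurable_fun [set: T] f /\
  P.-integrable [set: T] (fun w => (f w ^+ 2)%:E).

Definition ip f g : R := \int[P]_w (f w * g w).

Lemma L2_mul f g : L2 f -> L2 g ->
  P.-integrable [set: T] (fun w => (f w * g w)%:E).
Proof.
move=> [mf f2] [mg g2].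
apply: (le_integrable measurableT _ _ (integrableD measurableT f2 g2)).
  by apply/measurable_EFinP; exact: measurable_funM.
move=> w _ /=; rewrite lee_fin [leRHS]ger0_norm ?addr_ge0 ?sqr_ge0//.
by rewrite ler_norml; nra.
Qed.

Lemma L2_lin a f g : L2 f -> L2 g -> L2 (fun w => a * f w + g w).
Proof.
move=> Lf Lg; have [mf f2] := Lf; have [mg g2] := Lg; split.
  by apply: measurable_funD => //; exact: measurable_funM.
have i1 := integrableZl measurableT (a ^+ 2) f2.
have i2 := integrableZl measurableT (2 * a) (L2_mul Lf Lg).
have := integrableD measurableT (integrableD measurableT i1 i2) g2.
apply: eq_integrable => // w _ /=; rewrite -!EFinM -!EFinD.
by congr EFin; ring.
Qed.

Lemma L2_bounded M f : measurable_fun setT f -> (forall w, `|f w| <= M) -> L2 f.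
Proof.
move=> mf fM; split=> //.
apply: (@le_integrable _ _ _ P setT _ _ (cst (M ^+ 2)%:E)) => //.
- by apply/measurable_EFinP; exact: measurable_funX.
- move=> w _ /=;
    rewrite lee_fin !ger0_norm ?sqr_ge0// -[f w ^+ 2]real_normK ?num_real//.
  by rewrite ler_sqr ?nnegrE// (le_trans _ (fM w)).
- exact: finite_measure_integrable_cst.
Qed.

Lemma L2_cst a : L2 (cst a).
Proof. by apply: (@L2_bounded `|a|). Qed.

Lemma L2_indic (A : set T) : measurable A -> L2 \1_A.
Proof.
move=> mA; apply: (@L2_bounded 1); first exact: measurable_indic.
by move=> w; rewrite indicE; case: (_ \in _); rewrite ?normr1// normr0.
Qed.

Lemma L2_scale a f : L2 f -> L2 (fun w => a * f w).
Proof.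
move=> Lf; have := L2_lin a Lf (L2_cst 0).
by under eq_fun do rewrite addr0.
Qed.

Lemma L2_sub f g : L2 f -> L2 g -> L2 (fun w => f w - g w).
Proof.
move=> Lf Lg; have := L2_lin (-1) Lg Lf.
by under eq_fun do rewrite mulN1r addrC.
Qed.

Lemma L2_le f g : measurable_fun setT f -> L2 g ->
  (forall w, `|f w| <= `|g w|) ->
  L2 f.
Proof.
move=> mf [mg g2] fg; split=> //; apply: (le_integrable measurableT _ _ g2).
  by apply/measurable_EFinP; exact: measurable_funX.
move=> w _ /=; rewrite lee_fin !ger0_norm ?sqr_ge0//.
by rewrite -(real_normK (num_real (f w))) -(real_normK (num_real (g w)))
  ler_sqr.
Qed.

Lemma L2_sum (I : Type) (s : seq I) (c : I -> R) (f : I -> T -> R) :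
  (forall k, L2 (f k)) -> L2 (fun w => \sum_(k <- s) c k * f k w).
Proof.
move=> Lf; elim: s => [|k s IH].
  by under eq_fun do rewrite big_nil; exact: L2_cst.
have := L2_lin (c k) (Lf k) IH.
by congr L2; apply/funext => w; rewrite big_cons.
Qed.

Lemma L2_integrable f : L2 f -> P.-integrable [set: T] (fun w => (f w)%:E).
Proof.
move=> Lf; have := L2_mul Lf (L2_cst 1).
by under eq_fun do rewrite /cst mulr1.
Qed.

Lemma ipC f g : ip f g = ip g f.
Proof. by apply: eq_Rintegral => w _; rewrite mulrC. Qed.

Lemma ip_linl a f g h : L2 f -> L2 g -> L2 h ->
  ip (fun w => a * f w + g w) h = a * ip f h + ip g h.
Proof.
move=> Lf Lg Lh; rewrite /ip -RintegralZl//; last exact: L2_mul.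
rewrite -RintegralD//; last exact: L2_mul.
  by apply: eq_Rintegral => w _; rewrite mulrDl mulrA.
apply: eq_integrable (L2_mul (L2_scale a Lf) Lh) => // w _ /=.
by rewrite mulrA.
Qed.

Lemma ip_linr a f g h : L2 f -> L2 g -> L2 h ->
  ip h (fun w => a * f w + g w) = a * ip h f + ip h g.
Proof. by move=> *; rewrite ipC ip_linl// !(ipC h). Qed.

Lemma ip0l g : ip (cst 0) g = 0.
Proof.
rewrite /ip (_ : (fun w => _) = cst 0); last by apply/funext => w;
  rewrite mul0r.
by rewrite Rintegral_cst// mul0r.
Qed.

Lemma ip_subl f g h : L2 f -> L2 g -> L2 h ->
  ip (fun w => f w - g w) h = ip f h - ip g h.
Proof.
move=> Lf Lg Lh; rewrite -[RHS]addrC -mulN1r -ip_linl//; congr ip.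
by apply/funext => w; rewrite mulN1r addrC.
Qed.

Lemma ip_subr f g h : L2 f -> L2 g -> L2 h ->
  ip h (fun w => f w - g w) = ip h f - ip h g.
Proof. by move=> *; rewrite ipC ip_subl// !(ipC h). Qed.

Lemma ip_scalel a f h : L2 f -> L2 h -> ip (fun w => a * f w) h = a * ip f h.
Proof.
move=> Lf Lh; rewrite -[RHS]addr0 -(ip0l h) -ip_linl//; last exact: L2_cst.
by congr ip; apply/funext => w; rewrite addr0.
Qed.

Lemma ip_suml (I : Type) (s : seq I) (c : I -> R) (f : I -> T -> R) h :
  (forall k, L2 (f k)) -> L2 h ->
  ip (fun w => \sum_(k <- s) c k * f k w) h = \sum_(k <- s) c k * ip (f k) h.
Proof.
move=> Lf Lh; elim: s => [|k s IH].
  by rewrite big_nil -[RHS](ip0l h); congr ip; apply/funext => w;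
    rewrite big_nil.
rewrite big_cons -IH -ip_linl//; last exact: L2_sum.
by congr ip; apply/funext => w; rewrite big_cons.
Qed.

Lemma ip_sumr (I : Type) (s : seq I) (c : I -> R) (f : I -> T -> R) h :
  (forall k, L2 (f k)) -> L2 h ->
  ip h (fun w => \sum_(k <- s) c k * f k w) = \sum_(k <- s) c k * ip h (f k).
Proof.
by move=> Lf Lh; rewrite ipC ip_suml//; apply: eq_bigr => k _; rewrite ipC.
Qed.

Lemma ip_ge0 f : 0 <= ip f f.
Proof. by apply: Rintegral_ge0 => w _; rewrite -expr2 sqr_ge0. Qed.

Lemma cauchy_schwarz f g : L2 f -> L2 g ->
  `|ip f g| <= Num.sqrt (ip f f) * Num.sqrt (ip g g).
Proof.
move=> Lf Lg; rewrite -sqrtrM ?ip_ge0// -sqrtr_sqr ler_wsqrtr//.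
have key t : 0 <= t ^+ 2 * ip f f + 2 * t * ip f g + ip g g.
  have := ip_ge0 (fun w => t * f w + g w).
  rewrite ip_linl ?ip_linr//; last exact: L2_lin.
  by rewrite (ipC g f); congr (_ <= _); ring.
have [f0|f0] := eqVneq (ip f f) 0.
  rewrite f0 mul0r; have [->|fg0] := eqVneq (ip f g) 0; first by rewrite expr0n.
  (* With [ip f f = 0] the polynomial is affine in t; this t gives it the value -1. *)
  have := key (- (ip g g + 1) / (2 * ip f g)).
  rewrite f0 mulr0 add0r.
  rewrite (_ : 2 * _ * _ = - (ip g g + 1)); last by field.
  by lra.
have fp : 0 < ip f f by rewrite lt_def f0 ip_ge0.
have := key (- ip f g / ip f f).
rewrite (_ : _ + _ = (ip f f * ip g g - ip f g ^+ 2) / ip f f); last by field.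
by rewrite pmulr_lge0 ?invr_gt0// subr_ge0.
Qed.

(** The parallelogram identity, with the norm of f + g dropped. *)
Lemma ip_sub_sqr_le f g : L2 f -> L2 g ->
  ip (fun w => f w - g w) (fun w => f w - g w) <= 2 * (ip f f + ip g g).
Proof.
move=> Lf Lg; have := ip_ge0 (fun w => 1 * f w + g w).
rewrite ip_subl ?ip_subr//; last exact: L2_sub.
rewrite ip_linl ?ip_linr//; last exact: L2_lin.
by rewrite (ipC g f); lra.
Qed.

Lemma ip_ae_eq f g h : measurable_fun setT f -> measurable_fun setT g ->
  measurable_fun setT h -> (\forall w \ae P, f w = g w) -> ip f h = ip g h.
Proof.
move=> mf mg mh fg; rewrite /ip /Rintegral; congr fine.
apply: ae_eq_integral => //.
- by apply/measurable_EFinP; exact: measurable_funM.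
- by apply/measurable_EFinP; exact: measurable_funM.
- by apply: filterS fg => w fgw _; rewrite fgw.
Qed.

Lemma ip_indic A B : measurable A -> measurable B ->
  ip \1_A \1_B = fine (P (A `&` B)).
Proof.
move=> mA mB; rewrite /ip /Rintegral.
rewrite -[A `&` B]setIT -integral_indic//; last exact: measurableI.
by congr fine; apply: eq_integral => w _; rewrite indicI.
Qed.

Lemma ip_indicT f : ip f \1_setT = \int[P]_w f w.
Proof. by apply: eq_Rintegral => w _; rewrite indicT mulr1. Qed.

Lemma ip_indic_Rintegral f A : measurable A ->
  ip f \1_A = \int[P]_(w in A) f w.
Proof.
move=> mA; rewrite [RHS]Rintegral_mkcond; apply: eq_Rintegral => w _.
by rewrite patchE indicE; case: ifP; rewrite (mulr1, mulr0).
Qed.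

Lemma ip_indic_cst (S : set T) c : measurable S ->
  ip \1_S (cst c) = c * fine (P S).
Proof.
move=> mS; rewrite ipC (_ : cst c = fun w => c * \1_setT w); last first.
  by apply/funext => w; rewrite indicT mulr1.
rewrite ip_scalel ?ip_indic ?setTI//; exact: L2_indic.
Qed.

Lemma ip_indic_bounds (S : set T) (f : T -> R) m M : measurable S -> L2 f ->
  (forall w, m <= f w <= M) ->
  m * fine (P S) <= ip \1_S f <= M * fine (P S).
Proof.
move=> mS Lf fmM; have LS := L2_indic mS.
have ge0 h : (forall w, 0 <= h w) -> 0 <= ip \1_S h.
  by move=> h0; apply: Rintegral_ge0 => w _; rewrite mulr_ge0.
rewrite -!ip_indic_cst// -subr_ge0 -ip_subr//; last exact: L2_cst.
rewrite -[ip _ f <= _]subr_ge0 -ip_subr//; last exact: L2_cst.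
by apply/andP; split; apply: ge0 => w; rewrite subr_ge0; case/andP: (fmM w).
Qed.

Lemma cvg_ip_norm (f : nat -> T -> R) g h : (forall n, L2 (f n)) -> L2 g ->
  L2 h -> ip (fun w => f n w - g w) (fun w => f n w - g w) @[n --> \oo] --> 0 ->
  ip (f n) h @[n --> \oo] --> ip g h.
Proof.
move=> Lf Lg Lh fg; apply/cvgrPdist_le => /= e e0.
have {}fg : Num.sqrt (ip (fun w => f n w - g w) (fun w => f n w - g w)) *
    Num.sqrt (ip h h) @[n --> \oo] --> 0.
  rewrite -[X in _ --> X](mul0r (Num.sqrt (ip h h))); apply: cvgMl.
  rewrite -[X in _ --> X]sqrtr0; apply: continuous_cvg fg.
  exact: sqrt_continuous.
move/cvgrPdist_le: fg => /(_ _ e0); apply: filterS => n.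
rewrite sub0r normrN ger0_norm ?mulr_ge0 ?sqrtr_ge0// => le_e.
rewrite distrC -ip_subl// (le_trans _ le_e)// cauchy_schwarz//.
exact: L2_sub.
Qed.

(** By Cauchy-Schwarz, the uniform bound [K] makes the functionals [ip P (Z n)] equicontinuous, so a
    zero limit on a family passes to its L^2-limits. Boundedness is all that is known of the
    sequences [Z] met below. *)
Lemma ip_uniform_closure (Z : nat -> T -> R) K (f : nat -> T -> R) g :
  (forall n, L2 (Z n)) -> (forall n, ip (Z n) (Z n) <= K) ->
  (forall n, L2 (f n)) -> L2 g ->
  ip (fun w => f n w - g w) (fun w => f n w - g w) @[n --> \oo] --> 0 ->
  (forall m, ip (Z n) (f m) @[n --> \oo] --> 0) ->
  ip (Z n) g @[n --> \oo] --> 0.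
Proof.
move=> LZ ZK Lf Lg fg Zf; apply/cvgrPdist_le => /= e e0.
have : Num.sqrt K *
    Num.sqrt (ip (fun w => f n w - g w) (fun w => f n w - g w))
    @[n --> \oo] --> 0.
  rewrite -[X in _ --> X](mulr0 (Num.sqrt K)); apply: cvgMr.
  rewrite -[X in _ --> X]sqrtr0; apply: continuous_cvg fg.
  exact: sqrt_continuous.
move/cvgrPdist_le => /(_ (e / 2)); rewrite divr_gt0// => /(_ isT) [m _ /(_ m)].
rewrite /= leqnn sub0r normrN ger0_norm ?mulr_ge0 ?sqrtr_ge0// => /(_ isT) hm.
have /cvgrPdist_le /(_ (e / 2)) := Zf m.
rewrite divr_gt0// => /(_ isT); apply: filterS => n.
rewrite !sub0r !normrN => hn.
rewrite (_ : ip _ _ = ip (Z n) (f m) - ip (Z n) (fun w => f m w - g w));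
  last by rewrite ip_subr// subKr.
rewrite (splitr e) (le_trans (ler_normB _ _))// lerD//.
apply: le_trans hm; apply: le_trans (cauchy_schwarz _ _) _ => //.
  exact: L2_sub.
by rewrite ler_wpM2r ?sqrtr_ge0// ler_wsqrtr.
Qed.

Lemma cvg_L2_dominated (f : nat -> T -> R) g h :
  (forall n, measurable_fun setT (f n)) -> L2 g -> L2 h ->
  (forall w, f n w @[n --> \oo] --> g w) -> (forall n w, `|f n w| <= `|h w|) ->
  ip (fun w => f n w - g w) (fun w => f n w - g w) @[n --> \oo] --> 0.
Proof.
move=> mf [mg g2] [mh h2] fg fh.
have gh w : `|g w| <= `|h w|.
  apply: (@closed_cvg _ _ \oo _ (fun n => `|f n w|) (fun x => x <= `|h w|)).
  - exact: closed_le.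
  - by apply: nearW => n; exact: fh.
  - by apply: cvg_norm; exact: fg.
(* Both |f n| and |g| are at most |h|, hence the dominating function 4 h^2. *)
have [] // := @dominated_convergence _ _ _ P setT measurableT
   (fun n w => ((f n w - g w) * (f n w - g w))%:E) (cst 0)%E
   (fun w => 4%:E * (h w ^+ 2)%:E)%E.
- move=> n; apply/measurable_EFinP.
  by apply: measurable_funM; apply: measurable_funB.
- apply: aeW => w _; apply/fine_cvgP; split; first exact: nearW.
  rewrite -[X in _ --> X](mul0r 0) -(subrr (g w)) /=.
  by apply: cvgM; apply: cvgB => //; exact: cvg_cst.
- exact: integrableZl.
- apply: aeW => w n _; rewrite -EFinM lee_fin -expr2 ger0_norm ?sqr_ge0//.
  have := fh n w; have := gh w; rewrite -[h w ^+ 2]real_normK ?num_real//.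
  by rewrite !ler_norml => /andP[? ?] /andP[? ?]; nra.
move=> _ _; rewrite integral_cst// mul0e.
by move=> /fine_cvg.
Qed.

End L2.

(** * Testing against half-lines *)

Lemma cvg_sum_scale0 {R : realType} (I : Type) (s : seq I) (c : I -> R)
    (u : I -> nat -> R) : (forall i, u i n @[n --> \oo] --> 0) ->
  \sum_(i <- s) c i * u i n @[n --> \oo] --> 0.
Proof.
move=> u0; elim: s => [|i s IH].
  by under eq_fun do rewrite big_nil; exact: cvg_cst.
have ci0 : c i * u i n @[n --> \oo] --> c i * 0 by exact: cvgMr.
rewrite (_ : (fun n => _) = (fun n => c i * u i n + \sum_(j <- s) c j * u j n)).
  by have := cvgD ci0 IH; rewrite mulr0 addr0; exact.
by apply/funext => n; rewrite big_cons.
Qed.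

Section rays.
Context {R : realType}.

Definition rays : set (set R) := range (fun x => `]-oo, x]%classic).

(** Half-lines are the sets on which the copula is known. They form a pi-system, and ]a, b] is a
    difference of two of them, so Dynkin induction can start there. *)
Lemma measurable_rays : (@ocitv R).-sigma.-measurable = <<s rays >>.
Proof.
rewrite eqEsubset; split => A.
  apply: smallest_sub; first exact: smallest_sigma_algebra.
  move=> I [[a b] _ <-] /=.
  have -> : `]a, b]%classic = `]-oo, b] `\` `]-oo, a].
    apply/seteqP; split=> x /=; rewrite !in_itv/=.
      by move=> /andP[ax xb]; split=> //; rewrite leNgt ax.
    by move=> [xb /negP]; rewrite -ltNge xb andbT.
  have mr x : rays.-sigma.-measurable (`]-oo, x]%classic : set R).
    by apply: sub_sigma_algebra; exists x.
  exact: (@measurableD _ (g_sigma_algebraType rays)).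
apply: smallest_sub; first exact: smallest_sigma_algebra.
by move=> _ [x _ <-]; exact: measurable_itv.
Qed.

Lemma setI_closed_rays : setI_closed rays.
Proof.
move=> _ _ [x _ <-] [y _ <-]; exists (Num.min x y) => //.
by apply/seteqP; split=> z /=; rewrite !in_itv/= le_min => /andP.
Qed.

(** As in the Doob-Dynkin factorization, y(u) is the supremum of the rationals q with u in [D q].
    Nothing is claimed at points where the [D q] are not the levels of a number, which leaves room
    for null sets. *)
Lemma measurable_of_levels (D : rat -> set R) : (forall q, measurable (D q)) ->
  exists2 y : R -> R, measurable_fun setT y &
    forall z u, (forall q, D q u <-> ratr q < z) -> y u = z.
Proof.
move=> mD; pose q n : rat := odflt 0 (unpickle n).
pose f n u : \bar R := if u \in D (q n) then (ratr (q n))%:E else -oo%E.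
exists (fun u => fine (esups (f ^~ u) 0%N)).
  apply: (@measurableT_comp _ _ _ _ _ _ fine); first exact: fine_measurable.
  apply: measurable_fun_esups => n; apply: measurable_fun_ifT => //.
  apply: (measurable_fun_bool true); rewrite setTI.
  rewrite (_ : _ @^-1` _ = D (q n))//; apply/seteqP; split=> u /=.
    by move/set_mem.
  by move/mem_set.
move=> z u Dz; rewrite (_ : esups _ _ = z%:E)//; apply/eqP; rewrite eq_le.
apply/andP; split.
  apply: ge_ereal_sup => _ [n _ <-]; rewrite /f; case: ifPn => [|_].
    by rewrite inE => /Dz /ltW; rewrite lee_fin.
  exact: leNye.
have fq r : ratr r < z -> ((ratr r)%:E <= esups (f ^~ u) 0%N)%E.
  move=> rz; apply: ereal_sup_ubound; exists (pickle r) => //.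
  by rewrite /f /q pickleK/= mem_set//; apply/Dz.
rewrite leNgt; apply/negP => sz.
have [r sr rz] : exists2 r : R, (esups (f ^~ u) 0%N <= r%:E)%E & r < z.
  move: sz; case: (esups _ _) => [r| |]//.
  - by rewrite lte_fin => rz; exists r.
  - by exists (z - 1); rewrite ?leNye// ltrBlDr ltrDl.
have [p] := rat_in_itvoo rz; rewrite in_itv/= => /andP[rp pz].
by have := le_trans (fq _ pz) sr; rewrite lee_fin leNgt rp.
Qed.

End rays.

(** * Functions of one random variable: approximation and extension from half-lines *)

Section density.
Context {d : measure_display} {T : measurableType d} {R : realType}.
Variables (P : probability T R) (U : {mfun T >-> R}).

Import HBSimple HBNNSimple.

(** Simple functions of U increasing to g are dominated by g itself, so they converge in L^2. They
    are spelled out as sums of indicators to let linearity of [ip] act. *)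
Lemma ge0_L2_approx (g : R -> R) : measurable_fun setT g ->
  (forall x, 0 <= g x) ->
  L2 P (g \o U) ->
  exists (s : nat -> seq R) (B : nat -> R -> set R),
    [/\ forall n y, measurable (B n y), forall n y, y \in s n -> 0 <= y &
      let f := fun n w => \sum_(y <- s n) y * \1_(U @^-1` B n y) w in
      ip P (fun w => f n w - g (U w)) (fun w => f n w - g (U w)) @[n --> \oo]
        --> 0].
Proof.
move=> mg g0 Lg.
have /measurable_EFinP mg' := mg.
pose h n := nnsfun_approx measurableT mg' n.
exists (fun n => finmap.enum_fset (fset_set (range (h n)))), (fun n y => h n
  @^-1` [set y]); split.
- by move=> n y; exact: measurable_sfunP.
- move=> n y; rewrite in_fset_set; last exact: fimfunP.
  by rewrite inE => -[x _ <-].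
have hE n w : \sum_(y <- finmap.enum_fset (fset_set (range (h n))))
    y * \1_(U @^-1` (h n @^-1` [set y])) w = h n (U w).
  by rewrite [RHS]fimfunE fsbig_finite.
move=> f; have -> : f = (fun n w => h n (U w)).
  by apply/funext => n; apply/funext => w; exact: hE.
apply: (@cvg_L2_dominated _ _ _ P _ (g \o U) (g \o U)) => //.
- by move=> n; exact: measurableT_comp.
- move=> w; have /fine_cvgP[_] := cvg_nnsfun_approx measurableT mg'
    (fun x _ => g0 x) (I : setT (U w)).
  exact.
- move=> n w; rewrite !ger0_norm//; last exact: g0.
  by rewrite -lee_fin /h nnsfun_approxE; apply: le_approx => // x _;
    rewrite lee_fin.
Qed.

(** [Z] itself may change sign: only its conditional expectation given U is nonnegative. This
    carries the induction of Doeblin's argument. *)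
Lemma ip_ge0_of_indic Z (g : R -> R) : L2 P Z ->
  (forall B, measurable B -> 0 <= ip P Z \1_(U @^-1` B)) ->
  measurable_fun setT g -> (forall x, 0 <= g x) -> L2 P (g \o U) ->
  0 <= ip P Z (g \o U).
Proof.
move=> LZ ZB mg g0 Lg; have [s [B [mB s0 fg]]] := ge0_L2_approx mg g0 Lg.
have mUB n y : measurable (U @^-1` B n y) by exact: measurable_funPTI.
have LB n y := L2_indic P (mUB n y).
have cv := cvg_ip_norm (fun n => L2_sum (s n) id (LB n)) Lg LZ fg.
rewrite ipC; apply: (closed_cvg (fun x : R => 0 <= x)) cv.
  exact: closed_ge.
apply: nearW => n; rewrite ip_suml//.
rewrite big_seq; apply: sumr_ge0 => y ys; apply: mulr_ge0; first exact: s0 ys.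
by rewrite ipC; exact: ZB.
Qed.

Section vanishing.
Variables (Z : nat -> T -> R) (K : R).
Hypotheses (LZ : forall n, L2 P (Z n)) (ZK : forall n, ip P (Z n) (Z n) <= K).

(** Dynkin induction. Complements need the case of the whole line, and disjoint unions are
    L^2-limits of finite sums, where the bound [K] enters. *)
Lemma cvg_ip_indic (B : set R) :
  (forall u, ip P (Z n) \1_(U @^-1` `]-oo, u]) @[n --> \oo] --> 0) ->
  measurable B -> ip P (Z n) \1_(U @^-1` B) @[n --> \oo] --> 0.
Proof.
move=> Zr; have mU (A : set R) : measurable A -> measurable (U @^-1` A).
  by move=> mA; exact: measurable_funPTI.
have LU (A : set R) : measurable A -> L2 P \1_(U @^-1` A).
  by move=> mA; apply: L2_indic; exact: mU.
have indic_le1 (A : set T) w : `|\1_A w| <= `|cst 1 w : R|.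
  by rewrite normr1 indicE; case: (_ \in _); rewrite ?normr1 ?normr0.
(* The whole line is not a half-line, but its indicator is the L^2-limit of those of ]-oo, m]. *)
have ZT : ip P (Z n) \1_(U @^-1` setT) @[n --> \oo] --> 0.
  apply: (ip_uniform_closure LZ ZK (f := fun m => \1_(U @^-1` `]-oo, m%:R])))
    => //.
  - by move=> n; exact: LU.
  - exact: LU.
  - apply: (@cvg_L2_dominated _ _ _ P _ _ (cst 1)).
    + by move=> n; apply: measurable_indic; exact: mU.
    + exact: LU.
    + exact: L2_cst.
    + move=> w; rewrite preimage_setT indicT; apply: cvg_near_cst.
      near=> n; rewrite indicE mem_set//= in_itv/=; near: n.
      exact: nbhs_infty_ger.
    + by move=> n w; exact: indic_le1.
suff: forall S : set R, <<s rays >> S ->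
    ip P (Z n) \1_(U @^-1` S) @[n --> \oo] --> 0.
  move=> h mB; apply: h; move: mB; rewrite -measurable_rays; exact.
apply: (dynkin_induction measurable_rays setI_closed_rays) => //.
- by move=> _ [u _ <-]; exact: Zr.
- move=> S mS ZS.
  rewrite (_ : (fun n => _) = (fun n => ip P (Z n) \1_(U @^-1` setT) -
      ip P (Z n) \1_(U @^-1` S))); last first.
    apply/funext => n; rewrite -ip_subr//; [|exact: LU|exact: LU].
    congr ip; apply/funext => w; rewrite preimage_setC preimage_setT !indicE.
    by rewrite in_setC in_setT; case: (_ \in _); rewrite ?subrr ?subr0.
  by rewrite -[X in _ --> X](subrr 0); exact: cvgB.
- move=> F mF tF ZF.
  apply: (ip_uniform_closure LZ ZK
    (f := fun m w => \sum_(k <- index_iota 0 m) 1 * \1_(U @^-1` F k) w)) => //.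
  + by move=> m; apply: L2_sum => k; exact: LU (mF k).
  + by apply: LU; apply: bigcup_measurable => k _; exact: mF.
  (* By disjointness at most one indicator is nonzero at w, so the partial sum jumps from 0 to 1
     once its index is reached. *)
  + have sumE m w i : F i (U w) ->
        \sum_(k <- index_iota 0 m) 1 * \1_(U @^-1` F k) w = (i < m)%N%:R :> R.
      move=> Fi; have Fk k : \1_(U @^-1` F k) w = (k == i)%:R :> R.
        rewrite indicE; case: eqVneq => [->|ki]; first by rewrite mem_set.
        rewrite memNset//= => Fk; move/eqP: ki; apply.
        by apply: tF => //; exists (U w).
      elim: m => [|m IH]; first by rewrite big_geq.
      rewrite big_nat_recr//= IH mul1r Fk ltnS.
      by rewrite [(i <= m)%N]leq_eqVlt (eq_sym m); case: ltngtP => _;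
        rewrite ?addr0 ?add0r.
    have sum0 m w : (forall i, ~ F i (U w)) ->
        \sum_(k <- index_iota 0 m) 1 * \1_(U @^-1` F k) w = 0 :> R.
      by move=> nF; apply: big1 => k _; rewrite mul1r indicE memNset//;
        exact: nF.
    apply: (@cvg_L2_dominated _ _ _ P _ _ (cst 1)).
    * move=> m; apply: measurable_sum => k; apply: measurable_funM => //.
      by apply: measurable_indic; exact: mU (mF k).
    * by apply: LU; apply: bigcup_measurable => k _; exact: mF.
    * exact: L2_cst.
    * move=> w; have [[i Fi]|nF] := pselect (exists i, F i (U w)).
        rewrite indicE mem_set/=; last by exists i.
        apply: cvg_near_cst; near=> m; rewrite (sumE _ _ i)//.
        suff -> : (i < m)%N by [].
        by near: m; exact: nbhs_infty_gt.
      rewrite indicE memNset; last by move=> [i _ /= Fi]; apply: nF; exists i.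
      rewrite (_ : (fun m => _) = cst 0); first exact: cvg_cst.
      by apply/funext => m; rewrite sum0//; exact/forallNP.
    * move=> m w; rewrite normr1;
        have [[i Fi]|nF] := pselect (exists i, F i (U w)).
        by rewrite (sumE _ _ i)//; case: (_ < _)%N; rewrite ?normr1 ?normr0.
      by rewrite sum0 ?normr0//; exact/forallNP.
  + move=> m; rewrite (_ : (fun n => _) =
      (fun n => \sum_(k <- index_iota 0 m) 1 * ip P (Z n) \1_(U @^-1` F k)));
        last first.
      by apply/funext => n; rewrite ip_sumr// => k; exact: LU (mF k).
    by apply: cvg_sum_scale0 => k; exact: ZF.
Unshelve. all: by end_near. Qed.

Lemma cvg_ip_L2 (g : R -> R) :
  (forall u, ip P (Z n) \1_(U @^-1` `]-oo, u]) @[n --> \oo] --> 0) ->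
  measurable_fun setT g -> L2 P (g \o U) ->
  ip P (Z n) (g \o U) @[n --> \oo] --> 0.
Proof.
move=> Zr; have mU (A : set R) : measurable A -> measurable (U @^-1` A).
  by move=> mA; exact: measurable_funPTI.
have ge0 (h : R -> R) : measurable_fun setT h -> (forall x, 0 <= h x) ->
    L2 P (h \o U) -> ip P (Z n) (h \o U) @[n --> \oo] --> 0.
  move=> mh h0 Lh; have [s [B [mB _ fh]]] := ge0_L2_approx mh h0 Lh.
  have LB n y := L2_indic P (mU _ (mB n y)).
  apply: (ip_uniform_closure LZ ZK _ Lh fh) => m.
    by apply: L2_sum.
  rewrite (_ : (fun n => _) = (fun n => \sum_(y <- s m)
      y * ip P (Z n) \1_(U @^-1` B m y))); last first.
    by apply/funext => n; rewrite ip_sumr.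
  by apply: cvg_sum_scale0 => y; exact: cvg_ip_indic (mB m y).
move=> mg Lg; have mU0 : measurable_fun setT (U : T -> R) by [].
pose gp := g \max cst 0; pose gm := (- g) \max cst 0.
have mgp : measurable_fun setT gp by apply: measurable_maxr.
have mgm : measurable_fun setT gm.
  by apply: measurable_maxr => //; exact: measurableT_comp.
have Lgp : L2 P (gp \o U).
  apply: L2_le Lg _; first exact: measurableT_comp.
  by move=> w /=; rewrite /gp/=; case: (ltP (g (U w)) 0); rewrite ?normr0.
have Lgm : L2 P (gm \o U).
  apply: L2_le Lg _; first exact: measurableT_comp.
  by move=> w /=; rewrite /gm/= !fctE; case: (ltP (- g (U w)) 0);
    rewrite ?normr0 ?normrN.
have -> : g \o U = (fun w => (gp \o U) w - (gm \o U) w).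
  apply/funext => w /=; rewrite /gp /gm/= !fctE.
  by case: (ltP (g (U w)) 0); case: (ltP (- g (U w)) 0); lra.
rewrite (_ : (fun n => _) = (fun n => ip P (Z n) (gp \o U) -
    ip P (Z n) (gm \o U))); last by apply/funext => n; rewrite ip_subr.
rewrite -[X in _ --> X](subrr 0); apply: cvgB; apply: ge0 => // x.
  by rewrite /gp/= le_max lexx orbT.
by rewrite /gm/= le_max lexx orbT.
Qed.

End vanishing.

(** The vanishing result for the constant sequence [Z]. Applied to differences, it identifies
    conditional expectations given U. *)
Lemma ip_eq0_of_rays Z (g : R -> R) : L2 P Z ->
  (forall u, ip P Z \1_(U @^-1` `]-oo, u]) = 0) ->
  measurable_fun setT g -> L2 P (g \o U) -> ip P Z (g \o U) = 0.
Proof.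
move=> LZ Zr mg Lg.
have := @cvg_ip_L2 (fun=> Z) _ (fun=> LZ) (fun=> lexx _) g _ mg Lg.
move=> /(_ _)/cvg_lim => <- //; first by rewrite lim_cst.
by move=> u; rewrite Zr; exact: cvg_cst.
Qed.

End density.

(** * Chains diagonal in an orthonormal basis *)

Section orthonormal.
Context {d : measure_display} {T : measurableType d} {R : realType}.
Variables (P : probability T R) (q : nat -> T -> R).
Hypotheses (Lq : forall k, L2 P (q k))
  (orth : forall j k, ip P (q j) (q k) = (j == k)%:R).

Lemma ip_sum_orth (c : nat -> R) N k :
  ip P (fun w => \sum_(j < N) c j * q j w) (q k) = (k < N)%N%:R * c k.
Proof.
rewrite (ip_suml _ (fun j : 'I_N => c j) (fun j => Lq j) (Lq k)).
case: ltnP => [kN|Nk].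
  rewrite mul1r (bigD1 (Ordinal kN))//= orth eqxx mulr1 big1 ?addr0// => i.
  by rewrite -val_eqE/= => /negbTE ik; rewrite orth ik mulr0.
rewrite mul0r big1// => i _; rewrite orth; case: eqVneq => [ik|];
  last by rewrite mulr0.
by move: (ltn_ord i); rewrite ik ltnNge Nk.
Qed.

Lemma ip_sum_sqr (c : nat -> R) N :
  ip P (fun w => \sum_(j < N) c j * q j w) (fun w => \sum_(j < N) c j * q j w)
    = \sum_(j < N) c j ^+ 2.
Proof.
have LS : L2 P (fun w => \sum_(j < N) c j * q j w)
  by apply: (L2_sum _ (fun j : 'I_N => c j) (fun j => Lq j)).
rewrite (ip_sumr _ (fun j : 'I_N => c j) (fun j => Lq j) LS).
by apply: eq_bigr => k _; rewrite ip_sum_orth ltn_ord mul1r.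
Qed.

Lemma bessel (Z : T -> R) N : L2 P Z ->
  \sum_(j < N) ip P Z (q j) ^+ 2 <= ip P Z Z.
Proof.
move=> LZ; pose S w := \sum_(j < N) ip P Z (q j) * q j w.
have LS : L2 P S
  by apply: (L2_sum _ (fun j : 'I_N => ip P Z (q j)) (fun j => Lq j)).
have := ip_ge0 P (fun w => Z w - S w).
rewrite ip_subl ?ip_subr//; last exact: L2_sub.
have -> : ip P S S = \sum_(j < N) ip P Z (q j) ^+ 2 :=
  ip_sum_sqr (fun j => ip P Z (q j)) N.
rewrite (ipC P S Z).
rewrite /S (ip_sumr _ (fun j : 'I_N => ip P Z (q j)) (fun j => Lq j) LZ).
under eq_bigr do rewrite -expr2.
by lra.
Qed.

Lemma ip_orth_sqr_le (Z : T -> R) k : L2 P Z -> ip P Z (q k) ^+ 2 <= ip P Z Z.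
Proof.
move=> LZ; apply: le_trans (bessel k.+1 LZ).
by rewrite big_ord_recr/= lerDr; apply: sumr_ge0 => i _; exact: sqr_ge0.
Qed.

End orthonormal.

Section transfer.
Context {d : measure_display} {T : measurableType d} {R : realType}.
Variables (P : probability T R) (V W : {mfun T >-> R}) (e : nat -> R -> R).
Variables (L : nat -> R) (K : R).
Hypothesis me : forall k, measurable_fun setT (e k).
Hypothesis LeV : forall k, L2 P (e k \o V).
Hypothesis LeW : forall k, L2 P (e k \o W).
Hypothesis orthV : forall j k, ip P (e j \o V) (e k \o V) = (j == k)%:R.
Hypothesis orthW : forall j k, ip P (e j \o W) (e k \o W) = (j == k)%:R.
Hypothesis LK : forall N, \sum_(k < N) L k ^+ 2 <= K.

(* The partial sums of [\sum_k L k * E(Z e_k(V)) * e_k(W)] stay bounded in L^2,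
   so that testing on half-lines is enough to identify the coefficients. *)
Lemma ip_basis_of_rays Z : L2 P Z ->
  (forall v, \sum_(j < N) L j * ip P Z (e j \o V) *
       ip P \1_(W @^-1` `]-oo, v]) (e j \o W) @[N --> \oo] -->
     ip P Z \1_(W @^-1` `]-oo, v])) ->
  forall k, ip P Z (e k \o W) = L k * ip P Z (e k \o V).
Proof.
move=> LZ cvZ k; pose c j := L j * ip P Z (e j \o V).
pose h N w := \sum_(j < N) c j * (e j \o W) w.
have Lh N : L2 P (h N)
  by apply: (L2_sum _ (fun j : 'I_N => c j) (fun j => LeW j)).
have hK N : ip P (fun w => h N w - Z w) (fun w => h N w - Z w) <=
    2 * (ip P Z Z * K + ip P Z Z).
  apply: le_trans (ip_sub_sqr_le (Lh N) LZ) _.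
  rewrite ler_wpM2l// lerD2r (ip_sum_sqr LeW orthW).
  apply: le_trans (ler_wpM2l (ip_ge0 P Z) (LK N)).
  rewrite mulr_sumr; apply: ler_sum => j _; rewrite /c exprMn mulrC.
  by rewrite ler_wpM2r ?sqr_ge0//; exact: (ip_orth_sqr_le LeV orthV).
have cv0 : ip P (fun w => h N w - Z w) (e k \o W) @[N --> \oo] --> 0.
  apply: (cvg_ip_L2 (fun N => L2_sub (Lh N) LZ) hK) => // v.
  have mv : measurable (W @^-1` `]-oo, v]) by exact: measurable_funPTI.
  have Lv := L2_indic P mv.
  rewrite (_ : (fun N => _) = (fun N => (\sum_(j < N) c j *
      ip P \1_(W @^-1` `]-oo, v]) (e j \o W)) - ip P Z \1_(W @^-1` `]-oo, v]))).
    by rewrite -[X in _ --> X](subrr (ip P Z \1_(W @^-1` `]-oo, v])));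
      apply: cvgB; [exact: cvZ|exact: cvg_cst].
  apply/funext => N; rewrite ip_subl//; congr (_ - _); rewrite ipC.
  by rewrite (ip_sumr _ (fun j : 'I_N => c j) (fun j => LeW j) Lv).
(* For N > k the k-th coefficient of [h N] is exactly [c k]: the sequence tending to 0 is eventually
   constant. *)
apply/eqP; rewrite eq_sym -subr_eq0; apply/eqP.
apply: (cvg_unique _ _ cv0) => //; apply: cvg_near_cst; near=> N.
rewrite ip_subl// (ip_sum_orth LeW orthW).
suff -> : (k < N)%N by rewrite mul1r.
by near: N; exact: nbhs_infty_gt.
Unshelve. all: by end_near. Qed.

End transfer.

(** * Iteration of the diagonal one-step relation *)

Section chain.
Context {d : measure_display} {T : measurableType d} {R : realType}.
Variables (P : probability T R) (U : nat -> {mfun T >-> R}) (e : nat -> R -> R).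
Variables (L : nat -> R) (K : R) (init : set (set T)).
Hypothesis me : forall k, measurable_fun setT (e k).
Hypothesis law : forall n f g, measurable_fun setT f -> measurable_fun setT g ->
  ip P (f \o U n) (g \o U n) = ip P (f \o U 0%N) (g \o U 0%N).
Hypothesis lawL2 : forall n f, measurable_fun setT f ->
  L2 P (f \o U 0%N) -> L2 P (f \o U n).
Hypothesis Le0 : forall k, L2 P (e k \o U 0%N).
Hypothesis orth0 : forall j k, ip P (e j \o U 0%N) (e k \o U 0%N) = (j == k)%:R.
Hypothesis complete0 : forall g, measurable_fun setT g -> L2 P (g \o U 0%N) ->
  let r N w := \sum_(k < N) ip P (g \o U 0%N) (e k \o U 0%N) * e k (U 0%N w) -
    g (U 0%N w) in
  ip P (r N) (r N) @[N --> \oo] --> 0.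
Hypothesis LK : forall N, \sum_(k < N) L k ^+ 2 <= K.
Hypothesis copula : forall n u v,
  \sum_(k < N) L k * ip P \1_(U n @^-1` `]-oo, u]) (e k \o U n) *
    ip P \1_(U n.+1 @^-1` `]-oo, v]) (e k \o U n.+1) @[N --> \oo] -->
  ip P \1_(U n @^-1` `]-oo, u]) \1_(U n.+1 @^-1` `]-oo, v]).
(* [init] stands for the events of sigma(X_0); in [markov], y(U_n) is a version
   of the conditional probability of [U_{n+1} in B] given the past. *)
Hypothesis init_meas : forall A, init A -> measurable A.
Hypothesis initU : forall D, measurable D -> init (U 0%N @^-1` D).
Hypothesis markov : forall n B kappa, measurable B -> 0 <= kappa <= 1 ->
  (forall D, measurable D -> kappa * fine (P (U n @^-1` D)) <=
    fine (P (U n @^-1` D `&` U n.+1 @^-1` B))) ->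
  exists y : R -> R, [/\ measurable_fun setT y, (forall x, kappa <= y x <= 1),
    (forall A, init A ->
       ip P \1_A (y \o U n) = ip P \1_A \1_(U n.+1 @^-1` B)) &
    (forall D, measurable D -> ip P \1_(U n @^-1` D) (y \o U n) =
                               ip P \1_(U n @^-1` D) \1_(U n.+1 @^-1` B))].

Local Notation co f k := (ip P (f \o U 0%N) (e k \o U 0%N)).

Let mU n (A : set R) : measurable A -> measurable (U n @^-1` A).
Proof. by move=> mA; exact: measurable_funPTI. Qed.

Let mray u : measurable (`]-oo, u]%classic : set R).
Proof. exact: measurable_itv. Qed.

Let LU n A : measurable A -> L2 P \1_(U n @^-1` A).
Proof. by move=> mA; apply: L2_indic; exact: mU. Qed.

Let Le n k : L2 P (e k \o U n).
Proof. exact: lawL2. Qed.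

Let orth n j k : ip P (e j \o U n) (e k \o U n) = (j == k)%:R.
Proof. by rewrite law. Qed.

(** Parseval with only g expanded. Completeness, assumed at time 0, moves to time n because the norm
    of the residual depends only on the law of [U n]. *)
Lemma ip_expansion n Z g : L2 P Z -> measurable_fun setT g ->
  L2 P (g \o U 0%N) ->
  \sum_(k < N) co g k * ip P Z (e k \o U n) @[N --> \oo] --> ip P Z (g \o U n).
Proof.
move=> LZ mg Lg; rewrite ipC.
have Lgn := lawL2 n mg Lg.
have LS N : L2 P (fun w => \sum_(k < N) co g k * (e k \o U n) w).
  by apply: (L2_sum _ (fun j : 'I_N => co g j) (fun j => Le n j)).
have := cvg_ip_norm LS Lgn LZ.
rewrite (_ : (fun N => ip P _ Z) =
    (fun N => \sum_(k < N) co g k * ip P Z (e k \o U n))); last first.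
  by apply/funext => N;
    rewrite ipC (ip_sumr _ (fun j : 'I_N => co g j) (fun j => Le n j) LZ).
apply; have := complete0 mg Lg; rewrite /=.
pose r N x := \sum_(k < N) co g k * e k x - g x.
have mr N : measurable_fun setT (r N).
  apply: measurable_funB => //; apply: measurable_sum => k.
  exact: measurable_funM.
rewrite (_ : (fun N => _) = (fun N => ip P (r N \o U n) (r N \o U n)))//.
by apply/funext => N; rewrite law.
Qed.

(** The two half-lines of the copula are removed one after the other: that of [U m.+1] by
    [ip_basis_of_rays], with Z the indicator of a half-line event of [U m], then that of [U m] by
    [ip_eq0_of_rays]. *)
Lemma ip_step m f k : measurable_fun setT f -> L2 P (f \o U 0%N) ->
  ip P (f \o U m) (e k \o U m.+1) = L k * co f k.
Proof.
move=> mf Lf; rewrite -(law m mf (me k)) -ip_scalel ?Le//; last exact: lawL2.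
apply/eqP; rewrite -subr_eq0; apply/eqP.
have Lfm := lawL2 m mf Lf.
rewrite ip_scalel//; rewrite !(ipC _ (f \o U m)) -ip_scalel// -ip_subl//;
  last first.
  exact: L2_scale.
apply: ip_eq0_of_rays => //; first by apply: L2_sub => //; exact: L2_scale.
move=> u; rewrite ip_subl//; [|exact: L2_scale|exact: LU].
rewrite ip_scalel//; last exact: LU.
rewrite !(ipC _ _ \1_(U m @^-1` `]-oo, u])).
rewrite (ip_basis_of_rays (V := U m) (L := L) (K := K) me) ?subrr//.
exact: LU.
Qed.

Lemma ip_step_expansion m f g : measurable_fun setT f -> L2 P (f \o U 0%N) ->
  measurable_fun setT g -> L2 P (g \o U 0%N) ->
  \sum_(k < N) L k * co f k * co g k @[N --> \oo] -->
    ip P (f \o U m) (g \o U m.+1).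
Proof.
move=> mf Lf mg Lg; have := ip_expansion (n := m.+1) (lawL2 m mf Lf) mg Lg.
rewrite (_ : (fun N => _) = (fun N => \sum_(k < N) L k * co f k * co g k))//.
by apply/funext => N; apply: eq_bigr => k _; rewrite ip_step// mulrC.
Qed.

(** Time reversal: the expansion of [ip_step_expansion] is symmetric in f and g, and taking [e k]
    for f leaves a single term. *)
Lemma ip_step_sym m g k : measurable_fun setT g -> L2 P (g \o U 0%N) ->
  ip P (g \o U m.+1) (e k \o U m) = L k * co g k.
Proof.
move=> mg Lg; rewrite ipC.
have cv := ip_step_expansion (m := m) (me k) (Le0 k) mg Lg.
apply/esym; apply: (cvg_unique _ _ cv) => //.
apply: cvg_near_cst; near=> N.
have kN : (k < N)%N by near: N; exact: nbhs_infty_gt.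
rewrite (bigD1 (Ordinal kN))//= orth0 eqxx mulr1 big1 ?addr0// => i.
by rewrite -val_eqE/= => /negbTE ik; rewrite orth0 eq_sym ik mulr0 mul0r.
Unshelve. all: by end_near. Qed.

(** Since A is an event at time 0, the copula does not apply directly. The Markov property replaces
    the event U_{n+1} <= v by y(U_n); expanding y, whose coefficients are given by [ip_step_sym],
    yields the series required by [ip_basis_of_rays]. *)
Lemma ip_init_step n A k : init A ->
  ip P \1_A (e k \o U n.+1) = L k * ip P \1_A (e k \o U n).
Proof.
move=> iA; have LA := L2_indic P (init_meas iA).
apply: (ip_basis_of_rays (K := K) me) => // v.
have [//||D mD|y [my y01 yA yD]] := @markov n `]-oo, v] 0.
- by rewrite lexx ler01.
- by rewrite mul0r fine_ge0.
have Ly m : L2 P (y \o U m).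
  apply: (@L2_bounded _ _ _ P 1); first exact: measurableT_comp.
  by move=> w /=; have /andP[? ?] := y01 (U m w); rewrite ger0_norm.
rewrite -yA//; have := ip_expansion (n := n) LA my (Ly _).
rewrite (_ : (fun N => _) = (fun N => \sum_(j < N) L j * ip P \1_A (e j \o U
  n) *
   ip P \1_(U n.+1 @^-1` `]-oo, v]) (e j \o U n.+1)))//.
apply/funext => N; apply: eq_bigr => j _.
have mv : measurable_fun setT (\1_(`]-oo, v]%classic : set R) : R -> R).
  exact: measurable_indic.
have -> : co y j = L j * ip P \1_(U n.+1 @^-1` `]-oo, v]) (e j \o U n.+1).
  rewrite -(law n my (me j)) -[\1_(U n.+1 @^-1` _)]/(\1_(`]-oo, v]%classic) \o
    U n.+1).
  rewrite (law n.+1 mv (me j)) -(ip_step_sym n)//;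
    last exact: (LU 0%N (mray v)).
  (* y(U_n) and the indicator of U_{n+1} <= v have the same integral over half-line events of U_n,
     hence the same coefficients. *)
  apply/eqP; rewrite -subr_eq0 -ip_subl//; last exact: (LU _ (mray v)).
  apply/eqP; apply: ip_eq0_of_rays => //.
    by apply: L2_sub => //; exact: (LU _ (mray v)).
  move=> u; rewrite ip_subl//; [|exact: (LU _ (mray v))|exact: LU].
  rewrite ipC yD// ipC -[\1_(U n.+1 @^-1` _)]/(\1_(`]-oo, v]%classic) \o U
    n.+1).
  by rewrite subrr.
by rewrite [RHS]mulrAC mulrC.
Qed.

Lemma ip_chain n f k : measurable_fun setT f -> L2 P (f \o U 0%N) ->
  ip P (f \o U 0%N) (e k \o U n) = L k ^+ n * co f k.
Proof.
move=> mf Lf; elim: n => [|n IH]; first by rewrite mul1r.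
rewrite exprS -mulrA -IH.
apply/eqP; rewrite -subr_eq0; apply/eqP.
rewrite !(ipC _ (f \o U 0%N)) -ip_scalel// -ip_subl//; last exact: L2_scale.
apply: ip_eq0_of_rays => //; first by apply: L2_sub => //; exact: L2_scale.
move=> u; rewrite ip_subl//; [|exact: L2_scale|exact: LU].
rewrite ip_scalel//; last exact: LU.
rewrite !(ipC _ _ \1_(U 0%N @^-1` `]-oo, u])) ip_init_step ?subrr//.
exact: initU.
Qed.

Lemma ip_chain_expansion n f g : measurable_fun setT f -> L2 P (f \o U 0%N) ->
  measurable_fun setT g -> L2 P (g \o U 0%N) ->
  \sum_(k < N) L k ^+ n * co f k * co g k @[N --> \oo] -->
    ip P (f \o U 0%N) (g \o U n).
Proof.
move=> mf Lf mg Lg; have := ip_expansion (n := n) Lf mg Lg.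
rewrite (_ : (fun N => _) = (fun N => \sum_(k < N) L k ^+ n * co f k * co g
  k))//.
by apply/funext => N; apply: eq_bigr => k _; rewrite (ip_chain n k mf Lf) mulrC.
Qed.

(* Doeblin's argument: a one-step minorization by [eps] improves to
   [1 - (1 - eps) ^+ n] after n steps. *)
Lemma chain_minorization eps : 0 <= eps <= 1 ->
  (forall n D B, measurable D -> measurable B ->
    eps * fine (P (U n @^-1` D)) * fine (P (U n.+1 @^-1` B)) <=
    fine (P (U n @^-1` D `&` U n.+1 @^-1` B))) ->
  forall n A B, init A -> measurable B ->
    (1 - (1 - eps) ^+ n) * fine (P A) * fine (P (U n @^-1` B)) <=
    fine (P (A `&` U n @^-1` B)).
Proof.
move=> /andP[eps0 eps1] minor; elim=> [|n IH] A B iA mB.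
  by rewrite subrr !mul0r fine_ge0.
have mA := init_meas iA.
pose PB := fine (P (U n.+1 @^-1` B)); pose PA := fine (P A).
have fine_prob_le1 C : measurable C -> fine (P C) <= 1.
  move=> mC; rewrite -lee_fin fineK; first exact: probability_le1.
  exact: fin_num_measure.
have PB1 : 0 <= PB <= 1 by rewrite fine_ge0// fine_prob_le1//; exact: mU.
(* [kappa] is the lower bound that one step gives for the conditional probability of U_{n+1} in B;
   [delta] is the constant reached after n steps. *)
pose kappa := eps * PB; pose delta := 1 - (1 - eps) ^+ n.
have [|D mD|y [my yk yA yD]] := @markov n B kappa mB.
- by case/andP: PB1 => ? ?; rewrite mulr_ge0//= mulr_ile1.
- by rewrite /kappa mulrAC; exact: minor.
have Ly : L2 P (y \o U n).
  apply: (@L2_bounded _ _ _ P 1); first exact: measurableT_comp.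
  move=> w /=; have /andP[k1 ?] := yk (U n w); rewrite ger0_norm//.
  by apply: le_trans k1; case/andP: PB1 => ? ?; rewrite mulr_ge0.
have LT : L2 P \1_setT by exact: L2_indic.
have LA := L2_indic P mA.
have iT B' : measurable B' ->
  ip P \1_setT \1_(U n @^-1` B') = fine (P (U n @^-1` B')).
  by move=> mB'; rewrite ip_indic ?setTI//; exact: mU.
have EyT : ip P \1_setT (y \o U n) = PB.
  have := yD setT measurableT; rewrite preimage_setT => ->.
  by rewrite ip_indic ?setTI//; exact: mU.
have ET : ip P \1_setT (cst kappa \o U n) = kappa.
  by rewrite ip_indic_cst// probability_setT mulr1.
have EA : ip P \1_A (cst kappa \o U n) = kappa * PA by exact: ip_indic_cst.
have Lk : L2 P (cst kappa \o U n) by exact: L2_cst.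
(* By induction [Z] has a nonnegative integral on every event of [U n]. Testing it on y - kappa >= 0
   gives the lower bound kappa PA + delta PA (PB - kappa), and eps + delta (1 - eps) = 1 - (1 -
   eps)^(n+1). *)
pose Z w := \1_A w - delta * PA * \1_setT w.
have LZ : L2 P Z by apply: L2_sub => //; exact: L2_scale.
have := @ip_ge0_of_indic _ _ _ P (U n) Z (fun x => y x - kappa) LZ.
have Lyk : L2 P ((fun x => y x - kappa) \o U n) by exact: (L2_sub Ly Lk).
have -> : ip P Z ((fun x => y x - kappa) \o U n) =
    ip P \1_A \1_(U n.+1 @^-1` B) - kappa * PA - delta * PA * (PB - kappa).
  have -> : (fun x => y x - kappa) \o U n =
    (fun w => (y \o U n) w - (cst kappa \o U n) w) by [].
  rewrite ip_subr// /Z !ip_subl ?ip_scalel ?(yA A iA) ?EyT ?ET ?EA//;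
    try exact: L2_scale.
  by ring.
rewrite ip_indic//; last exact: mU.
move=> /(_ _ _ _ Lyk) h; rewrite -subr_ge0; apply: le_trans (h _ _ _) _ => //.
- move=> B' mB'; rewrite /Z ip_subl//; [|exact: L2_scale|exact: LU].
  rewrite ip_scalel//; last exact: LU.
  by rewrite iT// ip_indic ?subr_ge0 ?IH//; exact: mU.
- exact: measurable_funB.
- by move=> x; rewrite subr_ge0; case/andP: (yk x).
- by rewrite le_eqVlt; apply/orP; left; apply/eqP;
    rewrite exprS /delta /kappa /PA /PB; ring.
Qed.

End chain.

(** * Uniform random variables *)

Section almost_everywhere.
Context {d : measure_display} {T : measurableType d} {R : realType}.
Variable P : probability T R.

Lemma ae_all_countable (I : countType) (Q : I -> T -> Prop) :
  (forall i, \forall w \ae P, Q i w) -> \forall w \ae P, forall i, Q i w.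
Proof.
move=> aeQ; have : \forall w \ae P, forall n i, unpickle n = Some i -> Q i w.
  apply: ae_foralln => n; case: (unpickle n) => [i|].
    by apply: filterS (aeQ i) => w Qw j [<-].
  by apply: aeW => w j.
by apply: filterS => w + i; apply; exact: pickleK.
Qed.

Lemma integrable_ae_eq (f g : T -> \bar R) : P.-integrable setT f ->
  measurable_fun setT g -> (\forall w \ae P, f w = g w) -> P.-integrable setT g.
Proof.
move=> /integrableP[mf fi] mg fg; apply/integrableP; split=> //.
rewrite -(@ge0_ae_eq_integral _ _ _ P setT (fun w => `|f w|)%E)//.
- exact: measurableT_comp.
- exact: measurableT_comp.
- by apply: filterS fg => w -> _.
Qed.

Lemma L2_ae_eq (f g : T -> R) : L2 P f -> measurable_fun setT g ->
  (\forall w \ae P, f w = g w) -> L2 P g.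
Proof.
move=> [mf f2] mg fg; split=> //; apply: integrable_ae_eq f2 _ _.
  by apply/measurable_EFinP; exact: measurable_funX.
by apply: filterS fg => w ->.
Qed.

(** On the set where V < kappa the positive function kappa - V has integral at most 0, so the set is
    null. An inequality on that set alone can be checked from the defining property of a conditional
    probability. *)
Lemma ae_ge_of_Rintegral (V : T -> R) kappa :
  P.-integrable setT (EFin \o V) ->
  kappa * fine (P [set w | V w < kappa]) <=
    \int[P]_(w in [set w | V w < kappa]) V w ->
  \forall w \ae P, kappa <= V w.
Proof.
move=> iV; set S := [set w | _] => le_kV.
have mV : measurable_fun setT V by apply/measurable_EFinP; case/integrableP: iV.
have mS : measurable S.
  rewrite (_ : S = V @^-1` `]-oo, kappa[); last first.
    by apply/seteqP; split=> w /=; rewrite in_itv.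
  by rewrite -[X in measurable X]setTI; exact: mV.
have iVS := integrableS measurableT mS (@subsetT _ _) iV.
have ik : P.-integrable S (EFin \o cst kappa)
  by apply: finite_measure_integrable_cst.
have ikV : P.-integrable S (EFin \o (fun w => kappa - V w)).
  by apply: eq_integrable (integrableB mS ik iVS) => // w _ /=.
have mkV : measurable_fun S (fun w => (kappa - V w)%:E).
  by case/integrableP: ikV.
have I0 : (\int[P]_(w in S) `|(kappa - V w)%:E| = 0)%E.
  rewrite (eq_integral (fun w => (kappa - V w)%:E)); last first.
    by move=> w; rewrite inE /S/= => Vk; rewrite ger0_norm ?subr_ge0 ?ltW.
  have fin : (\int[P]_(w in S) (kappa - V w)%:E)%E \is a fin_num.
    exact: integrable_fin_num.
  rewrite -(fineK fin); congr EFin; apply/eqP; rewrite eq_le; apply/andP; split.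
    rewrite -[X in X <= _]/(\int[P]_(w in S) (kappa - V w)) RintegralB//.
    by rewrite Rintegral_cst// subr_le0.
  by apply: Rintegral_ge0 => w; rewrite /S/= => Vk; rewrite subr_ge0 ltW.
have := (ae_eq_integral_abs P mS mkV).1 I0.
apply: filterS => w Sw; rewrite leNgt; apply/negP => Vk.
by have [] := Sw Vk => /eqP; rewrite subr_eq0 => /eqP kV; move: Vk;
  rewrite kV ltxx.
Qed.

End almost_everywhere.

Section uniform.
Context {d : measure_display} {T : measurableType d} {R : realType}.
Variables (P : probability T R) (V : {mfun T >-> R}).
Local Notation mu := (@lebesgue_measure R).
Local Notation unit_itv := [set` `[(0 : R), 1]].
Hypothesis V01 : forall w, 0 <= V w <= 1.
Hypothesis PV : forall u, 0 <= u <= 1 -> P (V @^-1` `]-oo, u]) = u%:E.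

(* [measurableTypeR R], on which the Lebesgue measure is defined, has the same
   measurable sets as [R] but another display. *)
Let mVR : measurable_fun setT (V : T -> measurableTypeR R).
Proof. by move=> mT B mB; exact: (measurable_funPT V). Qed.

Let VR : {mfun T >-> measurableTypeR R} :=
  @mfun_Sub _ _ _ (measurableTypeR R) V (mem_set mVR).

Lemma uniform_law B : measurable B -> P (V @^-1` B) = mu (B `&` unit_itv).
Proof.
move=> mB; have m01 : measurable (unit_itv : set R) by exact: measurable_itv.
pose m2 : {measure set (measurableTypeR R) -> \bar R} := mrestr mu m01.
rewrite -[LHS]/(distribution P VR B) -[RHS]/(m2 B).
apply: (@measure_unique _ R (measurableTypeR R) rays
  (fun n => `]-oo, n%:R]%classic)
  measurable_rays setI_closed_rays _ _ (distribution P VR) m2) => //.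
- by move=> i; exists i%:R.
- apply/seteqP; split=> // x _; exists (Num.truncn x).+1 => //=.
  by rewrite in_itv/= ltW// truncnS_gt.
- move=> _ [u _ <-]; rewrite -[LHS]/(P (V @^-1` `]-oo, u])).
  rewrite -[RHS]/(mu (`]-oo, u]%classic `&` unit_itv)).
  have [u0|u0] := ltP u 0.
    rewrite (_ : _ @^-1` _ = set0); last first.
      apply/seteqP; split=> w //=; rewrite in_itv/= => Vu.
      by have /andP[V0 _] := V01 w; have := le_lt_trans (le_trans V0 Vu) u0;
        rewrite ltxx.
    rewrite (_ : _ `&` _ = set0) ?measure0//.
    apply/seteqP; split=> x //=; rewrite !in_itv/= => -[xu /andP[x0 _]].
    by have := le_lt_trans (le_trans x0 xu) u0; rewrite ltxx.
  have [u1|u1] := leP u 1.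
    rewrite PV ?u0//.
    rewrite (_ : _ `&` _ = `[0, u]%classic).
      rewrite lebesgue_measure_itv/= lte_fin; case: ltgtP u0 => // [u0 _|<- _].
        by rewrite sube0.
      by [].
    apply/seteqP; split=> x /=; rewrite !in_itv/=.
      by move=> [-> /andP[-> _]].
    by move=> /andP[x0 xu]; rewrite x0 xu (le_trans xu).
  rewrite (_ : _ @^-1` _ = V @^-1` `]-oo, 1]); last first.
    apply/seteqP; split=> w /=; rewrite !in_itv/=;
      have /andP[_ V1] := V01 w => //.
    by move=> _; rewrite (le_trans V1)// ltW.
  rewrite PV ?ler01 ?lexx// (_ : _ `&` _ = unit_itv).
    by rewrite lebesgue_measure_itv/= lte_fin ltr01 sube0.
  apply/seteqP; split=> x /=; rewrite !in_itv/=; first by case.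
  by move=> /andP[x0 x1]; rewrite x0 x1 (le_trans x1 (ltW u1)).
- move=> k; rewrite /= (le_lt_trans (probability_le1 _ _)) ?ltry//.
Qed.

(** The integral is by definition the difference of those of the positive and negative parts, to
    each of which the pushforward formula for nonnegative functions applies. *)
Lemma integral_uniform (h : R -> \bar R) : measurable_fun setT h ->
  (\int[P]_w h (V w) = \int[mu]_(x in unit_itv) h x)%E.
Proof.
move=> mh; have m01 : measurable (unit_itv : set R) by exact: measurable_itv.
have VI : V @^-1` unit_itv = setT.
  by apply/seteqP; split=> // w _ /=; rewrite in_itv/=.
have key (g : R -> \bar R) : measurable_fun setT g -> (forall x, 0 <= g x)%E ->
    (\int[P]_w g (V w) = \int[mu]_(x in unit_itv) g x)%E.
  move=> mg g0; rewrite -[LHS]/(\int[P]_(w in setT) (g \o V) w)%E -VI.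
  rewrite -(ge0_integral_pushforward mVR) //; last first.
    exact: measurable_funTS.
  rewrite -[LHS]/(\int[distribution P VR]_(x in unit_itv) g x)%E.
  apply: eq_measure_integral => A mA A01.
  rewrite -[LHS]/(P (V @^-1` A)) uniform_law//; congr (mu _).
  by apply/setIidPl.
rewrite integralE [RHS]integralE; congr (_ - _)%E.
  rewrite -key//; last exact: measurable_funepos.
  by apply: eq_integral => w _; rewrite -[RHS]/((h^\+ \o V) w)%E -funepos_comp.
rewrite -key//; last exact: measurable_funeneg.
  by apply: eq_integral => w _; rewrite -[RHS]/((h^\- \o V) w)%E -funeneg_comp.
Qed.

Lemma ip_uniform (f g : R -> R) : measurable_fun setT f ->
  measurable_fun setT g ->
  ip P (f \o V) (g \o V) = inner01 f g.
Proof.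
move=> mf mg; congr fine;
  apply: (integral_uniform (h := fun x => (f x * g x)%:E)).
by apply/measurable_EFinP; exact: measurable_funM.
Qed.

Lemma L2_uniform (f : R -> R) : measurable_fun setT f ->
  L2 P (f \o V) <-> square_integrable01 f.
Proof.
move=> mf; have m01 : measurable (unit_itv : set R) by exact: measurable_itv.
have mf2 : measurable_fun setT (fun x => (f x ^+ 2)%:E).
  by apply/measurable_EFinP; exact: measurable_funX.
have := integral_uniform (h := fun x => `|(f x ^+ 2)%:E|%E) _.
move=> /(_ _) h; split=> -[_ /integrableP[mf' fi]]; split.
- exact: measurable_funTS.
- apply/integrableP; split; first exact: measurable_funTS.
  by rewrite -h//; exact: measurableT_comp.
- exact: measurableT_comp.
- apply/integrableP; split.
    by apply/measurable_EFinP; apply: measurable_funX; exact: measurableT_comp.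
  by rewrite /= h//; exact: measurableT_comp.
Qed.

End uniform.

(** * The chain generated by the copula *)

Lemma nonneg_series_cvg {R : realType} (u : nat -> R) K :
  (forall n, 0 <= u n) ->
  (forall N, \sum_(k < N) u k <= K) -> cvgn (series u).
Proof.
move=> u0 uK; apply: nondecreasing_is_cvgn; first exact: nondecreasing_series.
by exists K => _ [N _ <-]; rewrite /series/= big_mkord.
Qed.

Section copula_chain.
Context {R : realType} {phi : nat -> R -> R} {lam : nat -> R}.
Hypothesis phi_basis : orthonormal_basis01 (with_one phi).
Hypothesis lam_l2 : cvgn (series (fun k => lam k ^+ 2)).
Context {d : measure_display} {T : measurableType d} {P : probability T R}.
Context {X : nat -> {RV P >-> R}} {F : R -> R}.
Hypothesis X_chain : generated_chain X (series_copula lam phi) F.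

Local Notation mu := (@lebesgue_measure R).
Local Notation unit_itv := [set` `[(0 : R), 1]].

Let m01 : measurable (unit_itv : set R). Proof. exact: measurable_itv. Qed.

(** Since [phi k] is constrained only on [0, 1], extension by 0 makes the functions measurable on
    the whole line, as composition with the U_n requires. *)
Definition basis01 (k : nat) : R -> R := (with_one phi k) \_ unit_itv.

(** The eigenvalue 1 goes with the constant function, so that the term uv of the copula becomes the
    term of index 0. *)
Definition eigenvalue01 (k : nat) : R := if k is j.+1 then lam j else 1.

Local Notation e := basis01.
Local Notation L := eigenvalue01.

Lemma basis01E k x : 0 <= x <= 1 -> e k x = with_one phi k x.
Proof. by move=> x01; rewrite /basis01 patchE mem_set//= in_itv. Qed.

Lemma measurable_basis01 k : measurable_fun setT (e k).
Proof.
apply/(measurable_restrictT _ m01).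
by have [[/(_ k)[]]] := phi_basis.
Qed.

Let me := measurable_basis01.

Lemma square_integrable_basis01 k : square_integrable01 (e k).
Proof.
split; first exact: measurable_funTS.
have [[/(_ k)[_ i2] _] _] := phi_basis.
apply: eq_integrable i2 => // x; rewrite inE/= in_itv/= => x01.
by rewrite basis01E.
Qed.

Lemma inner01_basis01 j k : inner01 (e j) (e k) = (j == k)%:R.
Proof.
have [[_ <-] _] := phi_basis; apply: eq_Rintegral => x.
by rewrite inE/= in_itv/= => x01; rewrite !basis01E.
Qed.

Lemma sum_sqr_le_lim N :
  \sum_(k < N) lam k ^+ 2 <= limn (series (fun k => lam k ^+ 2)).
Proof.
have := nondecreasing_cvgn_le (nondecreasing_series (P := xpredT)
  (fun n _ _ => sqr_ge0 (lam n))) lam_l2 N.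
by rewrite /series/= big_mkord.
Qed.

Lemma eigenvalue01_l2 N :
  \sum_(k < N) L k ^+ 2 <= 1 + limn (series (fun k => lam k ^+ 2)).
Proof.
case: N => [|N]; last by rewrite big_ord_recl/= expr1n lerD2l sum_sqr_le_lim.
by have := sum_sqr_le_lim 0; rewrite !big_ord0; lra.
Qed.

(** * The uniformized chain and its copula *)

Lemma df_cdf x : (F x)%:E = P (X 0%N @^-1` `]-oo, x]).
Proof. by have [_ _ /(_ 0%N x) <- _] := X_chain. Qed.

Lemma df_bounds x : 0 <= F x <= 1.
Proof.
rewrite -!lee_fin df_cdf measure_ge0 probability_le1//.
by exact: measurable_funPTI.
Qed.

Lemma df_nd x y : x <= y -> F x <= F y.
Proof.
move=> xy; rewrite -lee_fin; have [_ _ cF _] := X_chain.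
by rewrite -!(cF 0%N); exact: cdf_nondecreasing.
Qed.

Lemma measurable_df : measurable_fun setT F.
Proof. by apply: nondecreasing_measurable => // x y; exact: df_nd. Qed.

Let mFX n : measurable_fun setT (F \o X n).
Proof. exact: measurableT_comp measurable_df (measurable_funPT (X n)). Qed.

Definition uniformized n : {mfun T >-> R} := mfun_Sub (mem_set (mFX n)).
Arguments uniformized : simpl never.

Local Notation U := uniformized.

Let mU n (A : set R) : measurable A -> measurable (U n @^-1` A).
Proof. by move=> mA; exact: measurable_funPTI. Qed.

Let mX n (A : set R) : measurable A -> measurable (X n @^-1` A).
Proof. by move=> mA; exact: measurable_funPTI. Qed.

Let U01 n w : 0 <= U n w <= 1.
Proof. exact: df_bounds. Qed.

(** Every [phi k] is orthogonal to the constant 1, so the series vanishes termwise at v = 1. *)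
Lemma series_copula1 u : series_copula lam phi u 1 = u.
Proof.
rewrite /series_copula mulr1 (_ : series _ = cst 0).
  by rewrite lim_cst// addr0.
apply/funext => N; rewrite /series/= big1// => k _.
suff -> : \int[mu]_(y in `[0, 1]) phi k y = 0 by rewrite mulr0.
have [[_ /(_ 0%N k.+1) h] _] := phi_basis.
rewrite -[RHS]/((0%N == k.+1)%:R) -h.
by apply: eq_Rintegral => x _; rewrite /= mul1r.
Qed.

(** At v = 1 the condition on X_{n+1} always holds, so the copula gives the law of U_n. *)
Lemma uniformized_cdf n u : 0 <= u <= 1 -> P (U n @^-1` `]-oo, u]) = u%:E.
Proof.
move=> u01; have [_ _ _ /(_ n u 1)] := X_chain.
rewrite !in_itv/= u01 ler01 lexx series_copula1 => /(_ isT isT) <-.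
congr (P _); apply/seteqP; split=> w /=; rewrite in_itv/=.
  by move=> Uu; split=> //; have /andP[] := df_bounds (X n.+1 w).
by case.
Qed.

Let ip_U n := ip_uniform (U01 n) (@uniformized_cdf n).
Let L2_U n := L2_uniform (U01 n) (@uniformized_cdf n).

Let eq_lawU n f g : measurable_fun setT f -> measurable_fun setT g ->
  ip P (f \o U n) (g \o U n) = ip P (f \o U 0%N) (g \o U 0%N).
Proof. by move=> mf mg; rewrite !ip_U. Qed.

Let lawL2 n f : measurable_fun setT f -> L2 P (f \o U 0%N) -> L2 P (f \o U n).
Proof. by move=> mf; rewrite !L2_U. Qed.

Let Le n k : L2 P (e k \o U n).
Proof. by rewrite L2_U//; exact: square_integrable_basis01. Qed.

Let orth n j k : ip P (e j \o U n) (e k \o U n) = (j == k)%:R.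
Proof. by rewrite ip_U// inner01_basis01. Qed.

Let complete0 g : measurable_fun setT g -> L2 P (g \o U 0%N) ->
  let r N w := \sum_(k < N) ip P (g \o U 0%N) (e k \o U 0%N) * e k (U 0%N w) -
    g (U 0%N w) in
  ip P (r N) (r N) @[N --> \oo] --> 0.
Proof.
move=> mg Lg r; have [_ /(_ g)] := phi_basis.
move=> /(_ ((L2_U 0%N mg).1 Lg)); apply: cvg_trans.
apply: near_eq_cvg; apply: nearW => N.
pose s x := \sum_(k < N) ip P (g \o U 0%N) (e k \o U 0%N) * e k x - g x.
rewrite -[RHS]/(ip P (s \o U 0%N) (s \o U 0%N)) ip_U; last 2 first.
- apply: measurable_funB => //; apply: measurable_sum => k.
  exact: measurable_funM.
- apply: measurable_funB => //; apply: measurable_sum => k.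
  exact: measurable_funM.
apply: eq_Rintegral => x; rewrite inE/= in_itv/= => x01.
rewrite -expr2 -sqrrN opprB /s; congr ((_ - _) ^+ 2).
apply: eq_bigr => k _; rewrite basis01E//; congr (_ * _); rewrite ip_U//.
by apply: eq_Rintegral => y; rewrite inE/= in_itv/= => y01; rewrite basis01E.
Qed.

Let m_ray u : measurable (`]-oo, u]%classic : set R).
Proof. exact: measurable_itv. Qed.

Let LU n A : measurable A -> L2 P \1_(U n @^-1` A).
Proof. by move=> mA; apply: L2_indic; exact: mU. Qed.

Lemma ip_ray_basis n u k : 0 <= u <= 1 ->
  ip P \1_(U n @^-1` `]-oo, u]) (e k \o U n) =
  \int[mu]_(x in `[0, u]) with_one phi k x.
Proof.
move=> /andP[u0 u1];
  rewrite -[\1_(U n @^-1` _)]/(\1_(`]-oo, u]%classic) \o U n).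
rewrite ip_U//.
rewrite /inner01 Rintegral_mkcond [RHS]Rintegral_mkcond.
apply: eq_Rintegral => x _; rewrite !patchE indicE.
have [x01|x01] := boolP (x \in unit_itv).
  have x01' : 0 <= x <= 1 by move: x01; rewrite inE/= in_itv.
  rewrite basis01E//; case/andP: x01' => x0 x1.
  have -> : (x \in `]-oo, u]%classic) = (x <= u).
    by apply/idP/idP; rewrite inE/= in_itv.
  have -> : (x \in `[0, u]%classic) = (x <= u).
    by apply/idP/idP; rewrite inE/= in_itv/= x0.
  by case: (x <= u); rewrite ?mul1r ?mul0r.
rewrite memNset//=; rewrite in_itv/= => /andP[x0 xu]; move/negP: x01; apply.
by rewrite inE/= in_itv/= x0 (le_trans xu).
Qed.

Lemma copula_ray n u v : 0 <= u <= 1 -> 0 <= v <= 1 ->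
  \sum_(k < N) L k * ip P \1_(U n @^-1` `]-oo, u]) (e k \o U n) *
    ip P \1_(U n.+1 @^-1` `]-oo, v]) (e k \o U n.+1) @[N --> \oo] -->
  ip P \1_(U n @^-1` `]-oo, u]) \1_(U n.+1 @^-1` `]-oo, v]).
Proof.
move=> u01 v01; rewrite ip_indic//; [|exact: mU|exact: mU].
pose A k := ip P \1_(U n @^-1` `]-oo, u]) (e k \o U n).
pose B k := ip P \1_(U n.+1 @^-1` `]-oo, v]) (e k \o U n.+1).
have -> : P (U n @^-1` `]-oo, u] `&` U n.+1 @^-1` `]-oo, v]) =
    (series_copula lam phi u v)%:E.
  have [_ _ _ /(_ n u v)] := X_chain; rewrite !in_itv/= => /(_ u01 v01) <-.
  by congr (P _); apply/seteqP; split=> w /=; rewrite !in_itv.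
rewrite /=; pose t k := lam k * A k.+1 * B k.+1.
have prob1 (C : set T) : measurable C -> ip P \1_C \1_C <= 1.
  move=> mC; rewrite ip_indic// setIid -lee_fin fineK ?fin_num_measure//.
  exact: probability_le1.
have B1 k : B k ^+ 2 <= 1.
  apply: le_trans (ip_orth_sqr_le (Le n.+1) (orth n.+1) k (LU n.+1 (m_ray v)))
    _.
  by apply: prob1; exact: mU.
(* [limn] is meaningful only for a convergent series. The terms are dominated by lambda_k^2 + A_k^2,
   because |B_k| <= 1; the A_k^2 are summable by Bessel. *)
have cvt : cvgn (series t).
  apply: (@normed_cvg R R^o).
  apply: (@series_le_cvg _ _ (fun k => lam k ^+ 2 + A k.+1 ^+ 2)) => [k|k|k|].
  - exact: normr_ge0.
  - by rewrite addr_ge0 ?sqr_ge0.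
  - rewrite /= /t -mulrA !normrM.
    have : `|B k.+1| <= 1.
      by rewrite -(@ler_pXn2r _ 2)// ?nnegrE// real_normK ?num_real// expr1n.
    rewrite -(real_normK (num_real (lam k))) -(real_normK (num_real (A k.+1))).
    have := normr_ge0 (B k.+1); have := normr_ge0 (A k.+1);
      have := normr_ge0 (lam k).
    set b := `|B _|; set a := `|A _|; set l := `|lam _| => l0 a0 b0 b1.
    have : a * b <= a by rewrite ler_piMr.
    move=> ab; have lab : l * (a * b) <= l * a by rewrite ler_wpM2l.
    by have := sqr_ge0 (l - a); nra.
  - have cA : cvgn (series (fun k => A k.+1 ^+ 2)).
      apply: (@nonneg_series_cvg _ _ 1) => [k|N]; first exact: sqr_ge0.
      have := bessel (Le n) (orth n) N.+1 (LU n (m_ray u)).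
      move/le_trans => /(_ _ (prob1 _ (mU _ (m_ray u)))); apply: le_trans.
      by rewrite big_ord_recl/= lerDr sqr_ge0.
    rewrite (_ : series _ = series (fun k => lam k ^+ 2) \+
        series (fun k => A k.+1 ^+ 2)); first exact: is_cvgD.
    by apply/funext => N; rewrite /series/= -big_split.
(* The term of index 0 is u * v; the shift leaves the series of the copula. *)
rewrite -cvg_shiftS.
rewrite (_ : (fun N => _) = (fun N => u * v + series t N)).
  have -> : series_copula lam phi u v = u * v + limn (series t).
    rewrite /series_copula; congr (_ + limn (series _)); apply/funext => k.
    by rewrite /t /A /B !ip_ray_basis.
  by apply: cvgD; [exact: cvg_cst|exact: cvt].
have c1 m w : 0 <= w <= 1 ->
    ip P \1_(U m @^-1` `]-oo, w]) (e 0%N \o U m) = w.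
  move=> w01; rewrite ip_ray_basis//= Rintegral_cst// mul1r.
  have muw : mu (`[0, w]%classic : set R) = w%:E.
    rewrite lebesgue_measure_itv/= lte_fin; case/andP: w01; rewrite le_eqVlt.
    by move=> /predU1P[<-|->]; rewrite ?ltxx// sube0.
  exact: (congr1 fine muw).
apply/funext => N /=; rewrite big_ord_recl/= mul1r !c1//; congr (_ + _).
by rewrite /series/= big_mkord.
Qed.

(** U_n takes its values in [0, 1]: a half-line ending below 0 gives the empty event, one ending
    above 1 the same event as ]-oo, 1]. *)
Lemma copula_rays n u v :
  \sum_(k < N) L k * ip P \1_(U n @^-1` `]-oo, u]) (e k \o U n) *
    ip P \1_(U n.+1 @^-1` `]-oo, v]) (e k \o U n.+1) @[N --> \oo] -->
  ip P \1_(U n @^-1` `]-oo, u]) \1_(U n.+1 @^-1` `]-oo, v]).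
Proof.
have clamp m w : (U m @^-1` `]-oo, w] = set0) \/
    exists2 w', 0 <= w' <= 1 & U m @^-1` `]-oo, w] = U m @^-1` `]-oo, w'].
  have [w0|w0] := ltP w 0.
    left; apply/seteqP; split=> x //=; rewrite in_itv/= => Uw.
    by have /andP[U0 _] := U01 m x; have := le_lt_trans (le_trans U0 Uw) w0;
      rewrite ltxx.
  right; have [w1|w1] := leP w 1; first by exists w => //; rewrite w0.
  exists 1; first by rewrite ler01 lexx.
  apply/seteqP; split=> x /=; rewrite !in_itv/=;
    have /andP[_ U1] := U01 m x => //.
  by move=> _; rewrite (le_trans U1)// ltW.
have [->|[u' u01 ->]] := clamp n u.
  rewrite indic0 !ip0l (_ : (fun N => _) = cst 0); first exact: cvg_cst.
  by apply/funext => N; apply: big1 => k _; rewrite ip0l mulr0 mul0r.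
have [->|[v' v01 ->]] := clamp n.+1 v.
  rewrite indic0 ipC !ip0l (_ : (fun N => _) = cst 0); first exact: cvg_cst.
  by apply/funext => N; apply: big1 => k _; rewrite ip0l mulr0.
exact: copula_ray.
Qed.

(* The chain is recovered almost surely from its uniformization, by a version of
   the quantile function. *)
Lemma quantile : exists2 G : R -> R, measurable_fun setT G &
  forall n, \forall w \ae P, X n w = G (U n w).
Proof.
have [|G mG GE] := @measurable_of_levels R
  (fun q => `]F (ratr q), +oo[%classic).
  by move=> q; exact: measurable_itv.
exists G => // n.
(* The converse implication holds by monotonicity; this one can fail only where F is constant
   between q and X_n. *)
suff : \forall w \ae P, forall q : rat, ratr q < X n w -> F (ratr q) < U n w.
  apply: filterS => w Xw; apply/esym; apply: GE => q.
  rewrite /= in_itv/= andbT; split; last exact: Xw.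
  by rewrite !ltNge; apply: contraNN; exact: df_nd.
apply: ae_all_countable => q; set r := ratr q.
(* The exceptional event F(X_n) <= F(r), X_n > r has probability F(r) - F(r) = 0, since U_n is
   uniform. *)
exists ((U n @^-1` `]-oo, F r]) `\` (X n @^-1` `]-oo, r])); split.
- by apply: measurableD; [exact: mU|exact: mX].
- rewrite measureD; [|exact: mU|exact: mX|]; last first.
    by rewrite (le_lt_trans (probability_le1 _ _)) ?ltry//; exact: mU.
  rewrite (_ : _ `&` _ = X n @^-1` `]-oo, r]); last first.
    apply/seteqP; split=> w /=; first by case.
    by rewrite !in_itv/= => Xr; split=> //; exact: df_nd.
  transitivity (P (U n @^-1` `]-oo, F r]) - P (X n @^-1` `]-oo, r]))%E => //.
  rewrite (uniformized_cdf n (df_bounds r)).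
  transitivity ((F r)%:E - cdf (X n) r)%E => //.
  by have [_ _ -> _] := X_chain; rewrite subee.
- move=> w /= /not_implyP[rX /negP]; rewrite -leNgt => UF.
  by split; rewrite !in_itv//=; apply/negP; rewrite -ltNge.
Qed.

(** * Conditional probabilities as functions of U_n *)

Lemma sigma_of1 n A : sigma_of X [set n] A ->
  exists2 D, measurable D & A = X n @^-1` D.
Proof.
suff : sigma_of X [set n] `<=` preimage_set_system setT (X n) measurable.
  by move=> h /h [D mD <-]; exists D => //; rewrite setTI.
apply: smallest_sub.
  by apply: sigma_algebra_preimage; exact: sigma_algebra_measurable.
by rewrite bigcup_set1.
Qed.

Lemma sigma_of_preimage (I : set nat) i D : I i -> measurable D ->
  sigma_of X I (X i @^-1` D).
Proof.
move=> Ii mD; apply: sub_sigma_algebra; exists i => //.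
by exists D => //; rewrite setTI.
Qed.

(** The variable Y of the Markov property is a version for both sigma-algebras, so one y serves
    events at time 0 and events of U_n. Y factors through X_n by its rational levels, then through
    U_n by the quantile. The parameter [kappa] turns a minorization of probabilities into a
    pointwise bound on y. *)
Lemma markov_kernel n B kappa : measurable B -> 0 <= kappa <= 1 ->
  (forall D, measurable D -> kappa * fine (P (U n @^-1` D)) <=
    fine (P (U n @^-1` D `&` U n.+1 @^-1` B))) ->
  exists y : R -> R, [/\ measurable_fun setT y, (forall x, kappa <= y x <= 1),
    (forall A, (exists2 D, measurable D & A = X 0%N @^-1` D) ->
       ip P \1_A (y \o U n) = ip P \1_A \1_(U n.+1 @^-1` B)) &
    (forall D, measurable D -> ip P \1_(U n @^-1` D) (y \o U n) =
                               ip P \1_(U n @^-1` D) \1_(U n.+1 @^-1` B))].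
Proof.
move=> mB /andP[k0 k1] kP; pose E := U n.+1 @^-1` B.
have mE : measurable E by exact: mU.
have preF C : measurable C -> measurable (F @^-1` C).
  by move=> mC; rewrite -[X in measurable X]setTI; exact: measurable_df.
have [_ mk _ _] := X_chain.
have [Y [[_ _ YE] [Ysig iY Y1]]] := mk n (F @^-1` B) (preF _ mB).
have /choice[D DE] : forall q : rat, exists D : set R, measurable D /\
    Y @^-1` `]ratr q, +oo[ = X n @^-1` D.
  move=> q; have [|D mD YD] := @sigma_of1 n (Y @^-1` `]ratr q, +oo[).
    by apply: Ysig; exact: measurable_itv.
  by exists D.
have [G mG XG] := quantile.
have [|y0 my0 y0E] := @measurable_of_levels R (fun q => G @^-1` D q).
  by move=> q; rewrite -[X in measurable X]setTI; apply: mG => //;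
    exact: (DE q).1.
have aeY : \forall w \ae P, Y w = y0 (U n w).
  apply: filterS (XG n) => w Xw; apply/esym; apply: y0E => q.
  rewrite /preimage/= -Xw -[D q (X n w)]/((X n @^-1` D q) w) -(DE q).2/=.
  by rewrite in_itv/= andbT.
have mY : measurable_fun setT Y by apply/measurable_EFinP; case/integrableP: iY.
have my0U : measurable_fun setT (y0 \o U n) by exact: measurableT_comp.
have iy0 : P.-integrable setT (EFin \o (y0 \o U n)).
  apply: (integrable_ae_eq iY); first exact/measurable_EFinP.
  by apply: filterS aeY => w /= ->.
have intS C : measurable C -> \int[P]_(w in U n @^-1` C) (y0 \o U n) w =
    fine (P (U n @^-1` C `&` E)).
  move=> mC; rewrite -ip_indic_Rintegral; last exact: mU.
  rewrite -(@ip_ae_eq _ _ _ P Y) //; last by apply: measurable_indic; exact: mU.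
  rewrite ip_indic_Rintegral; last exact: mU.
  rewrite /Rintegral -Y1//; apply: (sigma_of_preimage (D := F @^-1` C)) => //.
  exact: preF.
have ge_k : \forall w \ae P, kappa <= (y0 \o U n) w.
  apply: ae_ge_of_Rintegral => //.
  have mC : measurable (y0 @^-1` `]-oo, kappa[).
    by rewrite -[X in measurable X]setTI; exact: my0.
  rewrite (_ : [set w | _] = U n @^-1` (y0 @^-1` `]-oo, kappa[)); last first.
    by apply/seteqP; split=> w /=; rewrite in_itv.
  by rewrite intS//; exact: kP.
have le_1 : \forall w \ae P, (y0 \o U n) w <= 1.
  (* The upper bound on y0 is a lower bound on -y0. *)
  suff : \forall w \ae P, -1 <= -1 * (y0 \o U n) w.
    by apply: filterS => w; rewrite mulN1r lerN2.
  apply: ae_ge_of_Rintegral.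
    by apply: eq_integrable (integrableZl measurableT (-1) iy0) => // w _ /=.
  have mC : measurable (y0 @^-1` `]1, +oo[).
    by rewrite -[X in measurable X]setTI; exact: my0.
  rewrite (_ : [set w | _] = U n @^-1` (y0 @^-1` `]1, +oo[)); last first.
    by apply/seteqP; split=> w /=; rewrite in_itv/= andbT mulN1r ltrN2.
  rewrite RintegralZl//; [|exact: mU|]; last first.
    by apply: integrableS iy0 => //; exact: mU.
  rewrite intS// !mulN1r lerN2 fine_le ?fin_num_measure//.
  - by apply: measurableI => //; exact: mU.
  - exact: mU.
  - by apply: le_measure; rewrite ?inE//; [apply: measurableI => //|];exact: mU.
(* Truncation alters y0(U_n) only on a null set and makes the bounds hold at every point. *)
pose y x := Num.min 1 (Num.max kappa (y0 x)).
have my : measurable_fun setT y.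
  by apply: measurable_minr => //; apply: measurable_maxr.
have aeyY : \forall w \ae P, Y w = (y \o U n) w.
  apply: filterS3 aeY ge_k le_1 => w -> /= ky y1; rewrite /y.
  by rewrite (max_idPr ky) (min_idPr y1).
have ipy A : measurable A -> ip P \1_A (y \o U n) = \int[P]_(w in A) Y w.
  move=> mA; have myU : measurable_fun setT (y \o U n)
    by exact: measurableT_comp.
  have m1A : measurable_fun setT (\1_A : T -> R) by exact: measurable_indic.
  by rewrite ipC -(ip_ae_eq mY myU m1A aeyY) ip_indic_Rintegral.
exists y; split=> //.
- by move=> x; rewrite /y le_min k1 le_max lexx/= ge_min lexx.
- move=> A [C mC eqA]; have mA : measurable A by rewrite eqA; exact: mX.
  rewrite ipy// ip_indic// /Rintegral -YE// eqA.
  exact: (@sigma_of_preimage `I_n.+1 0%N).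
- move=> C mC; rewrite ipy; last exact: mU.
  rewrite ip_indic//; last exact: mU.
  rewrite /Rintegral -Y1//; apply: (sigma_of_preimage (D := F @^-1` C)) => //.
  exact: preF.
Qed.

Let init A := exists2 D : set R, measurable D & A = X 0%N @^-1` D.

Let init_meas A : init A -> measurable A.
Proof. by move=> [D mD ->]; exact: mX. Qed.

Let initU D : measurable D -> init (U 0%N @^-1` D).
Proof.
move=> mD; exists (F @^-1` D) => //.
by rewrite -[X in measurable X]setTI; exact: measurable_df.
Qed.

Lemma fine_uniformized n B : measurable B ->
  fine (P (U n @^-1` B)) = fine (P (U 0%N @^-1` B)).
Proof.
move=> mB; congr fine.
by rewrite (uniform_law (U01 n) (@uniformized_cdf n))// (uniform_law (U01 0)
  (@uniformized_cdf 0)).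
Qed.

Lemma preimage_uniformized n (G : R -> R) B : measurable_fun setT G ->
  (forall n, \forall w \ae P, X n w = G (U n w)) -> measurable B ->
  \forall w \ae P, \1_(X n @^-1` B) w = \1_(U n @^-1` (G @^-1` B)) w :> R.
Proof.
by move=> mG XG mB; apply: filterS (XG n) => w Xw;
  rewrite -[LHS]/(\1_B (X n w)) Xw.
Qed.

(** [p A] is the preimage of A by the quantile function, which stays hidden. The form with two
    indicators of U feeds the spectral expansion; the mixed form, keeping X_0, is the one that
    Doeblin's argument bounds. *)
Lemma joint_law_uniformized : exists2 p : set R -> set R,
  (forall A, measurable A -> measurable (p A)) &
  forall n A B, measurable A -> measurable B ->
    [/\ joint_law X n A B = ip P \1_(U 0%N @^-1` p A) \1_(U n @^-1` p B),
        joint_law X n A B = fine (P (X 0%N @^-1` A `&` U n @^-1` p B)) &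
        law X B = fine (P (U 0%N @^-1` p B))].
Proof.
have [G mG XG] := quantile.
have mp A : measurable A -> measurable (G @^-1` A).
  by move=> mA; rewrite -[X in measurable X]setTI; exact: mG.
exists (fun A => G @^-1` A) => // n A B mA mB.
have ae m C := @preimage_uniformized m G C mG XG.
have mXi m C : measurable C -> measurable_fun setT (\1_(X m @^-1` C) : T -> R).
  by move=> mC; apply: measurable_indic; exact: mX.
have mUi m C : measurable C -> measurable_fun setT (\1_(U m @^-1` C) : T -> R).
  by move=> mC; apply: measurable_indic; exact: mU.
have eq1 : joint_law X n A B = ip P \1_(X 0%N @^-1` A)
    \1_(U n @^-1` (G @^-1` B)).
  rewrite /joint_law -ip_indic; [|exact: mX|exact: mX].
  rewrite ipC (ip_ae_eq (mXi n B mB) (mUi n _ (mp B mB)) (mXi 0%N A mA)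
    (ae n B mB)).
  exact: ipC.
split.
- by rewrite eq1 (ip_ae_eq (mXi 0%N A mA) (mUi 0%N _ (mp A mA))
    (mUi n _ (mp B mB)) (ae 0%N A mA)).
- by rewrite eq1 ip_indic//; [exact: mX|apply: mU; exact: mp].
- have mT : measurable_fun setT (\1_setT : T -> R) by exact: measurable_indic.
  have := ip_ae_eq (mXi 0%N B mB) (mUi 0%N _ (mp B mB)) mT (ae 0%N B mB).
  by rewrite (ip_indic P (mX 0%N mB) measurableT)
    (ip_indic P (mU 0%N (mp B mB)) measurableT) !setIT.
Qed.

(** * Bounds on the mixing coefficients *)

Lemma joint_lawTT n : joint_law X n setT setT = 1.
Proof. by rewrite /joint_law !preimage_setT setIT probability_setT. Qed.

Lemma lawT : law X setT = 1.
Proof. by rewrite /law preimage_setT probability_setT. Qed.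

Lemma charged_setT : charged X (setT, setT).
Proof. by split=> //=; rewrite lawT mulr1 ltr01. Qed.

Let expansion n f g := @ip_chain_expansion _ _ _ P U e L _ init me eq_lawU lawL2
  (Le 0%N) (orth 0%N) complete0 eigenvalue01_l2 copula_rays init_meas initU
  markov_kernel n f g.

Let step_expansion m f g := @ip_step_expansion _ _ _ P U e L _ me eq_lawU lawL2
  (Le 0%N) (orth 0%N) complete0 eigenvalue01_l2 copula_rays m f g.

Let minorization := @chain_minorization _ _ _ P U init init_meas markov_kernel.

Let e0U n : e 0%N \o U n = \1_setT.
Proof. by apply/funext => w; rewrite indicT/= basis01E ?U01. Qed.

Let ip_e0 A : measurable A ->
  ip P (\1_A \o U 0%N) (e 0%N \o U 0%N) = fine (P (U 0%N @^-1` A)).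
Proof.
move=> mA; rewrite e0U -[\1_A \o _]/(\1_(U 0%N @^-1` A)).
by rewrite ip_indic ?setIT//; exact: mU.
Qed.

(** Two of the n.+2 factors are spent on the convergent sum of lambda_k^2, as that of |lambda_k| may
    diverge; the n others give the rate. *)
Lemma sum_eigenvalue_le s n (a b : nat -> R) c N :
  (forall k, `|lam k| <= s) -> (forall k, `|a k * b k| <= c) ->
  `|\sum_(k < N) lam k ^+ n.+2 * a k * b k| <=
    s ^+ n * (c * limn (series (fun k => lam k ^+ 2))).
Proof.
move=> lams abc; have s0 : 0 <= s by exact: le_trans (normr_ge0 _) (lams 0%N).
have c0 : 0 <= c by exact: le_trans (normr_ge0 _) (abc 0%N).
apply: le_trans (ler_norm_sum _ _ _) _.
apply: (@le_trans _ _ (\sum_(k < N) s ^+ n * (c * lam k ^+ 2))); last first.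
  by rewrite -!mulr_sumr !ler_wpM2l ?exprn_ge0// sum_sqr_le_lim.
apply: ler_sum => k _.
rewrite (_ : `|_| = `|lam k| ^+ n * (`|a k * b k| * lam k ^+ 2)); last first.
  rewrite -mulrA normrM normrX -addn2 exprD real_normK ?num_real// -mulrA.
  by congr (_ * _); exact: mulrC.
apply: ler_pM; [exact: exprn_ge0|by rewrite mulr_ge0 ?sqr_ge0| |].
  by apply: lerXn2r; rewrite ?nnegrE.
by rewrite ler_wpM2r ?sqr_ge0.
Qed.

Lemma psi_coef_ge0 n : (0 <= psi_coef X n)%E.
Proof.
apply: le_ereal_sup_tmp; eexists; first by exists (setT, setT);
  [exact: charged_setT|].
by rewrite lee_fin /= lawT mulr1 divr1.
Qed.

(** A coefficient of the indicator of an event is at most M times its probability, which provides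
    the factor P(A) P(B) of the denominator. *)
Lemma psi_coef_le M s n : (forall k x, 0 <= x <= 1 -> `|phi k x| <= M) ->
  (forall k, `|lam k| <= s) ->
  (psi_coef X n.+2 <=
    (s ^+ n * (M ^+ 2 * limn (series (fun k => lam k ^+ 2))))%:E)%E.
Proof.
move=> phiM lams; have [p mp pE] := joint_law_uniformized.
apply: ge_ereal_sup => _ [[A B] [/= mA mB AB0] <-]; rewrite lee_fin.
rewrite ler_pdivrMr//.
have [-> _ lB] := pE n.+2 A B mA mB; have [_ _ lA] := pE n.+2 B A mB mA.
pose f : R -> R := \1_(p A); pose g : R -> R := \1_(p B).
have mf : measurable_fun setT f by apply: measurable_indic; exact: mp.
have mg : measurable_fun setT g by apply: measurable_indic; exact: mp.
have cv := @expansion n.+2 _ _ mf (LU 0%N (mp A mA)) mg (LU 0%N (mp B mB)).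
pose a k := ip P (f \o U 0%N) (e k \o U 0%N).
pose b k := ip P (g \o U 0%N) (e k \o U 0%N).
have aM C k : measurable C ->
  `|ip P (\1_(p C) \o U 0%N) (e k.+1 \o U 0%N)| <= M * law X C.
  move=> mC; have [_ _ ->] := pE 0%N C C mC mC.
  have := @ip_indic_bounds _ _ _ P _ _ (- M) M (mU 0%N (mp C mC)) (Le 0%N k.+1).
  rewrite mulNr -ler_norml; apply => w.
  by rewrite -ler_norml /= (basis01E k.+1 (U01 0%N w)) phiM//; exact: U01.
have a0 : a 0%N = law X A by rewrite lA -ip_e0//; exact: mp.
have b0 : b 0%N = law X B by rewrite lB -ip_e0//; exact: mp.
have cv' : `|\sum_(k < N.+1) L k ^+ n.+2 * a k * b k - law X A * law X B|
    @[N --> \oo] --> `|ip P (f \o U 0%N) (g \o U n.+2) - law X A * law X B|.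
  apply: cvg_norm; apply: cvgB; last exact: cvg_cst.
  by move: cv; rewrite -cvg_shiftS.
apply: (closed_cvg (fun x : R => x <= s ^+ n *
  (M ^+ 2 * limn (series (fun k => lam k ^+ 2))) * (law X A * law X B))) cv'.
  exact: closed_le.
(* The term of index 0 is [law X A * law X B] and cancels. *)
apply: nearW => N; rewrite big_ord_recl/= expr1n mul1r a0 b0 addrC addKr.
rewrite (_ : s ^+ n * _ * _ = s ^+ n *
  ((M * law X A) * (M * law X B) * limn (series (fun k => lam k ^+ 2))));
  last by ring.
apply: (@sum_eigenvalue_le s n (fun k => a k.+1) (fun k => b k.+1)) => // k.
by rewrite normrM ler_pM//; [exact: aM|exact: aM].
Qed.

Lemma rho_coef_le s n : (forall k, `|lam k| <= s) ->
  (rho_coef X n <= (s ^+ n)%:E)%E.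
Proof.
move=> lams; have s0 : 0 <= s by exact: le_trans (normr_ge0 _) (lams 0%N).
have [G mG XG] := quantile.
apply: ge_ereal_sup => _ [f [mf Ef0 Ef1] <-].
have mfG : measurable_fun setT (f \o G) by exact: measurableT_comp.
have mfX m : measurable_fun setT (f \o X m) by exact: measurableT_comp.
have mfGU m : measurable_fun setT ((f \o G) \o U m) by exact: measurableT_comp.
have aef m : \forall w \ae P, (f \o X m) w = ((f \o G) \o U m) w.
  by apply: filterS (XG m) => w /= <-.
move: Ef0 Ef1; rewrite !unlock => Ef0 Ef1.
have L2fX : L2 P (f \o X 0%N).
  split=> //; apply/integrableP; split.
    by apply/measurable_EFinP; exact: measurable_funX.
  under eq_integral do rewrite gee0_abs ?lee_fin ?sqr_ge0//.
  by rewrite Ef1 ltry.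
have L2f : L2 P ((f \o G) \o U 0%N) by exact: L2_ae_eq L2fX _ (aef 0%N).
have L2fXn : L2 P (f \o X n).
  apply: L2_ae_eq (lawL2 n mfG L2f) _ _ => //.
  by apply: filterS (aef n) => w ->.
have -> : (\int[P]_w (f (X 0%N w) * f (X n w))%:E)%E =
    (ip P ((f \o G) \o U 0%N) ((f \o G) \o U n))%:E.
  rewrite -(ip_ae_eq (mfX 0%N) (mfGU 0%N) (mfGU n) (aef 0%N)).
  rewrite ipC -(ip_ae_eq (mfX n) (mfGU n) (mfX 0%N) (aef n)) ipC.
  by rewrite /ip /Rintegral fineK//; apply: integrable_fin_num => //;
    exact: L2_mul.
have cv := @expansion n _ _ mfG L2f mfG L2f.
pose a k := ip P ((f \o G) \o U 0%N) (e k \o U 0%N).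
(* Centering removes the eigenvalue 1, the only one not covered by the bound [s]. *)
have a0 : a 0%N = 0.
  rewrite /a e0U -(ip_ae_eq (mfX 0%N) (mfGU 0%N) _ (aef 0%N))// ip_indicT.
  by rewrite /Rintegral Ef0.
have a1 : ip P ((f \o G) \o U 0%N) ((f \o G) \o U 0%N) = 1.
  rewrite -(ip_ae_eq (mfX 0%N) (mfGU 0%N) (mfGU 0%N) (aef 0%N)).
  rewrite ipC -(ip_ae_eq (mfX 0%N) (mfGU 0%N) (mfX 0%N) (aef 0%N)).
  rewrite /ip /Rintegral; under eq_integral do rewrite -expr2.
  by rewrite Ef1.
rewrite lee_fin; move/cvg_norm: cv => cv.
apply: (closed_cvg (fun x : R => x <= s ^+ n)) cv; first exact: closed_le.
apply: nearW => N; apply: le_trans (ler_norm_sum _ _ _) _.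
apply: (@le_trans _ _ (\sum_(k < N) s ^+ n * a k ^+ 2)).
  apply: ler_sum => -[[|k] kN] _; rewrite -/(a _) /= -mulrA -expr2.
    by rewrite a0 expr0n/= mulr0 normr0 mulr0.
  rewrite normrM normrX [X in _ * X]ger0_norm ?sqr_ge0//.
  by rewrite ler_wpM2r ?sqr_ge0// lerXn2r ?nnegrE.
rewrite -mulr_sumr -[leRHS]mulr1 ler_wpM2l ?exprn_ge0//.
by rewrite -a1; exact: (bessel (Le 0%N) (orth 0%N)).
Qed.

(** The function e_1(U_0) is admissible, so the supremum is not that of the empty set, which would
    be -oo. *)
Lemma rho_coef_ge0 n : (0 <= rho_coef X n)%E.
Proof.
apply: (le_trans (abse_ge0 ('E_P[fun w =>
  (e 1%N \o F) (X 0%N w) * (e 1%N \o F) (X n w)]))).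
apply: ereal_sup_ubound; exists (e 1%N \o F) => //; split.
- by apply: measurableT_comp => //; exact: measurable_df.
- rewrite unlock; have : ip P (e 0%N \o U 0%N) (e 1%N \o U 0%N) = 0.
    exact: orth.
  rewrite e0U ipC ip_indicT /Rintegral => h; rewrite -[RHS]/(0%:E) -h fineK//.
  by apply: integrable_fin_num => //; exact: (L2_integrable (Le 0%N 1%N)).
- rewrite unlock; have := orth 0%N 1%N 1%N; rewrite /ip /Rintegral => h.
  rewrite -[RHS]/(1%:E) -[X in X%:E]h fineK//.
  by apply: integrable_fin_num => //; exact: (L2_mul (Le 0%N 1%N) (Le 0%N 1%N)).
Qed.

Lemma psi'_coef_le1 n : (psi'_coef X n <= 1)%E.
Proof.
apply: ereal_inf_lbound; exists (setT, setT); first exact: charged_setT.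
by rewrite /= joint_lawTT lawT mulr1 divr1.
Qed.

(** Both coefficients lie between the extrema of [phi k] times the probabilities. For lambda_k < 0
    this bounds their product from above through absolute values; for lambda_k > 0 the extrema have
    opposite signs, so min times max bounds the product from below. *)
Lemma eigenvalue_product_ge (alpha : nat -> R) k m D B :
  is_alpha lam phi alpha ->
  measurable D -> measurable B ->
  lam k * alpha k * (fine (P (U m @^-1` D)) * fine (P (U m @^-1` B))) <=
  lam k * ip P (\1_D \o U m) (e k.+1 \o U m) *
    ip P (\1_B \o U m) (e k.+1 \o U m).
Proof.
move=> /(_ k)[al_neg al_pos] mD mB.
pose p := fine (P (U m @^-1` D)); pose q := fine (P (U m @^-1` B)).
have p0 : 0 <= p by exact: fine_ge0.
have q0 : 0 <= q by exact: fine_ge0.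
have bnd C c c' : measurable C ->
    (forall x, unit_itv x -> c <= phi k x <= c') ->
    c * fine (P (U m @^-1` C)) <= ip P (\1_C \o U m) (e k.+1 \o U m) <=
    c' * fine (P (U m @^-1` C)).
  move=> mC phic; apply: (ip_indic_bounds (mU m mC) (Le m k.+1)) => w.
  by rewrite /= (basis01E k.+1 (U01 m w)); apply: phic; rewrite /= in_itv/=;
    exact: U01.
rewrite -/p -/q; set a := ip P (\1_D \o _) _; set b := ip P (\1_B \o _) _.
rewrite -!mulrA; have [lam_neg|lam_pos|->] := ltgtP (lam k) 0;
  last by rewrite !mul0r.
  rewrite ler_nM2l//; have [[x0 _ <-] max] := al_neg lam_neg.
  pose c := `|phi k x0|.
  have c2 : phi k x0 ^+ 2 = c ^+ 2 by rewrite real_normK ?num_real.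
  have c0 : 0 <= c by exact: normr_ge0.
  have phic x : unit_itv x -> - c <= phi k x <= c.
    move=> x01; rewrite -ler_norml -(@ler_pXn2r _ 2) ?nnegrE//.
    by rewrite -c2 real_normK ?num_real//; apply: max; exists x.
  have := bnd D _ _ mD phic; have := bnd B _ _ mB phic;
    rewrite -/a -/b -/p -/q c2.
  rewrite !mulNr -!ler_norml => bq ap.
  apply: le_trans (ler_norm _) _; rewrite normrM.
  by rewrite (_ : c ^+ 2 * (p * q) = (c * p) * (c * q)); [exact: ler_pM|ring].
rewrite ler_pM2l//; have [c [c' [[_ minc] [_ maxc'] ->]]] := al_pos lam_pos.
have phic x : unit_itv x -> c <= phi k x <= c'.
  by move=> x01; rewrite minc ?maxc'//; exists x.
(* On the whole line the bounds surround the mean of [phi k], which is 0 by orthogonality to 1: min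
   <= 0 <= max. *)
have := bnd setT _ _ measurableT phic.
rewrite -[\1_setT \o U m]/(\1_setT) -(e0U m) orth /= preimage_setT
  probability_setT !mulr1.
have := bnd D _ _ mD phic; have := bnd B _ _ mB phic; rewrite -/a -/b -/p -/q.
move=> /andP[b1 b2] /andP[a1 a2] /andP[c0 c'0].
have cc : c * c' * (p * q) <= 0
  by rewrite mulr_le0_ge0 ?mulr_ge0// mulr_le0_ge0.
(* With equal signs the product is nonnegative and the bound is at most 0; with opposite signs each
   factor is replaced by the extremum of its own sign. *)
have [a0|a0] := leP 0 a; have [b0|b0] := leP 0 b.
- by apply: le_trans cc _; exact: mulr_ge0.
- have h1 : c' * p * b <= a * b by rewrite ler_wnM2r// ltW.
  have h2 : c' * p * (c * q) <= c' * p * b by rewrite ler_wpM2l// mulr_ge0.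
  by apply: le_trans h1; apply: le_trans h2; rewrite le_eqVlt; apply/orP;
    left; apply/eqP; ring.
- have h1 : a * (c' * q) <= a * b by rewrite ler_wnM2l// ltW.
  have h2 : c * p * (c' * q) <= a * (c' * q) by rewrite ler_wpM2r// mulr_ge0.
  by apply: le_trans h1; apply: le_trans h2; rewrite le_eqVlt; apply/orP;
    left; apply/eqP; ring.
- by apply: le_trans cc _; rewrite mulr_le0// ltW.
Qed.

Section psi'.
Variable alpha : nat -> R.
Hypotheses (al : is_alpha lam phi alpha)
  (cal : cvgn (series (fun k => lam k * alpha k))).
Let eps := 1 + limn (series (fun k => lam k * alpha k)).

(** Partial sums are compared term by term before the limit: index 0 gives the product of the
    probabilities, and [eigenvalue_product_ge] bounds each later term. *)
Lemma one_step_minorization m D B : measurable D -> measurable B ->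
  eps * fine (P (U m @^-1` D)) * fine (P (U m.+1 @^-1` B)) <=
  fine (P (U m @^-1` D `&` U m.+1 @^-1` B)).
Proof.
move=> mD mB; rewrite (fine_uniformized m mD) (fine_uniformized m.+1 mB) -mulrA.
set pq := (fine _ * fine _).
have mf : measurable_fun setT (\1_D : R -> R) by exact: measurable_indic.
have mg : measurable_fun setT (\1_B : R -> R) by exact: measurable_indic.
have := step_expansion (m := m) mf (LU 0%N mD) mg (LU 0%N mB).
rewrite -cvg_shiftS.
rewrite -[ip P (\1_D \o U m) _]/(ip P \1_(U m @^-1` D) \1_(U m.+1 @^-1` B)).
rewrite ip_indic; [|exact: mU|exact: mU] => cv.
have cv' : (1 + series (fun k => lam k * alpha k) N) * pq @[N --> \oo] -->
    eps * pq.
  by apply: cvgMl; apply: cvgD; [exact: cvg_cst|exact: cal].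
apply: (ler_cvg_to cv' cv); apply: nearW => N.
rewrite /= big_ord_recl/= mul1r !ip_e0// mulrDl mul1r lerD2l /series/=
  big_mkord.
rewrite mulr_suml; apply: ler_sum => k _.
exact: eigenvalue_product_ge.
Qed.

(** Both events are taken to be the whole space. This makes the ratio 1 - eps of Doeblin's rate
    nonnegative. *)
Lemma minorization_le1 : eps <= 1.
Proof.
have := one_step_minorization 0 measurableT measurableT.
by rewrite !preimage_setT setIT probability_setT !mulr1.
Qed.

Lemma psi'_coef_ge n : 0 <= eps -> ((1 - (1 - eps) ^+ n)%:E <= psi'_coef X n)%E.
Proof.
move=> eps0; have [p mp pE] := joint_law_uniformized.
have eps1 := minorization_le1.
apply: le_ereal_inf_tmp => _ [[A B] [/= mA mB AB0] <-].
rewrite lee_fin ler_pdivlMr//.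
have [_ -> ->] := pE n A B mA mB; rewrite mulrA -(fine_uniformized n (mp B mB)).
apply: minorization => //; first by rewrite eps0 eps1.
- by move=> m D C mD mC; exact: one_step_minorization.
- by exists A.
- exact: mp.
Qed.

End psi'.

End copula_chain.

(** * Passage to the limit *)

Lemma squeeze_cvge_geometric (R : realType) (u : nat -> \bar R) (s c : R) n0 :
  `|s| < 1 -> (forall n, 0 <= u n)%E ->
  (forall n, u (n + n0)%N <= (s ^+ n * c)%:E)%E -> u @ \oo --> 0%E.
Proof.
move=> s1 u0 us; rewrite -(cvg_shiftn n0).
have cv : (s ^+ n * c)%:E @[n --> \oo] --> 0%E.
  apply: cvg_EFin; first exact: nearW.
  by rewrite -[X in _ --> X](mul0r c); apply: cvgMl; exact: cvg_expr.
apply: (squeeze_cvge _ (cvg_cst 0%E) cv).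
by apply: nearW => n /=; rewrite u0 us.
Qed.

Lemma ereal_sup_norm_lt1 (R : realType) (lam : nat -> R) :
  (ereal_sup (range (fun k => `|lam k|%:E)) < 1)%E ->
  exists2 s : R, `|s| < 1 & forall k, `|lam k| <= s.
Proof.
set S := ereal_sup _ => S1.
have lamS k : (`|lam k|%:E <= S)%E by apply: ereal_sup_ubound; exists k.
have S0 : (0 <= S)%E by apply: le_trans (lamS 0%N); rewrite lee_fin.
have Sfin : S \is a fin_num by rewrite ge0_fin_numE// (lt_trans S1)// ltry.
exists (fine S); first by rewrite ger0_norm ?fine_ge0// -lte_fin fineK.
by move=> k; rewrite -lee_fin fineK.
Qed.

Theorem theorem3p4 (R : realType) (phi : nat -> R -> R) (lam : nat -> R)
    (phi_basis : orthonormal_basis01 (with_one phi))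
    (lam_l2 : cvgn (series (fun k => lam k ^+ 2)))
    (density_ge0 : nonnegative_density lam phi)
    (d : measure_display) (T : measurableType d) (P : probability T R)
    (X : nat -> {RV P >-> R}) (F : R -> R)
    (F_ac : absolutely_continuous_df F)
    (X_chain : generated_chain X (series_copula lam phi) F) :
  [/\ (exists M : R, forall k x, x \in `[0, 1] -> `|phi k x| <= M) ->
      (ereal_sup (range (fun k => `|lam k|%:E)) < 1)%E ->
      psi_mixing X,
      (ereal_sup (range (fun k => `|lam k|%:E)) < 1)%E ->
      rho_mixing X
    & forall alpha : nat -> R, is_alpha lam phi alpha ->
      cvgn (series (fun k => lam k * alpha k)) ->
      0 < 1 + limn (series (fun k => lam k * alpha k)) ->
      psi'_mixing X].
Proof.
split.
- move=> [M phiM] /ereal_sup_norm_lt1[s s1 lams].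
  (* The bound on psi holds from n = 2 on, hence the offset. *)
  apply: (@squeeze_cvge_geometric _ _ s _ 2) => // [n|n];
    first exact: psi_coef_ge0.
  rewrite addn2; apply: (psi_coef_le phi_basis lam_l2 X_chain (M := M)) => //.
- move=> /ereal_sup_norm_lt1[s s1 lams].
  apply: (@squeeze_cvge_geometric _ _ s 1 0) => // n.
    exact: (rho_coef_ge0 phi_basis X_chain).
  by rewrite addn0 mulr1; exact: (rho_coef_le phi_basis lam_l2 X_chain).
- move=> alpha al cal; set eps := 1 + _ => eps0.
  have cv : (1 - (1 - eps) ^+ n)%:E @[n --> \oo] --> 1%E.
    apply: cvg_EFin; first exact: nearW.
    rewrite -[X in _ --> X]subr0; apply: cvgB; first exact: cvg_cst.
    apply: cvg_expr; rewrite ger0_norm; first by rewrite gtrBl.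
    by rewrite subr_ge0;
      exact: (minorization_le1 phi_basis lam_l2 X_chain al cal).
  apply: (squeeze_cvge _ cv (cvg_cst 1%E)).
  apply: nearW => n; rewrite psi'_coef_le1 andbT.
  exact: (psi'_coef_ge phi_basis lam_l2 X_chain al cal _ (ltW eps0)).
Qed.
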